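(* Let $n-1\geqslant 4$, let $\varepsilon=\pm1$ and $a,b\in\mathbb{R}$. (1) Every $(n-1)$-dimensional Einstein manifold $(\widetilde N,\tilde g)$ satisfies $$\widetilde S_{\mu}{}^{\epsilon}\widetilde R_{\epsilon\beta\gamma\delta}=\frac{\tilde\kappa}{n-1}\,\widetilde R_{\mu\beta\gamma\delta}+\varepsilon a^2\bigl(\tilde g_{\beta\gamma}\widetilde S_{\mu\delta}-\tilde g_{\beta\delta}\widetilde S_{\mu\gamma}\bigr)-\frac{\varepsilon\tilde\kappa a^2}{n-1}\,\widetilde G_{\mu\beta\gamma\delta}.$$ (2) Thus every warped product $\overline M\times_F\widetilde N$ with $1$-dimensional base $(\overline M,\bar g)$, $\bar g_{11}=\varepsilon$, with fiber an $(n-1)$-dimensional Einstein manifold $(\widetilde N,\tilde g)$ which is not a space of constant curvature, and with warping function $F(x^1)=(ax^1+b)^2$ (positive on $\overline M$) satisfies $$R\cdot C-C\cdot R=\frac{1}{n-2}\,Q(S,R).$$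
   Context: All manifolds are connected, paracompact and $C^\infty$. For a semi-Riemannian manifold $(M,g)$ of dimension $n$ with Levi-Civita connection $\nabla$ and a symmetric $(0,2)$-tensor $A$: $(X\wedge_AY)Z=A(Y,Z)X-A(X,Z)Y$; $\mathcal R(X,Y)Z=\nabla_X\nabla_YZ-\nabla_Y\nabla_XZ-\nabla_{[X,Y]}Z$; $S(X,Y)=\mathrm{tr}\{Z\mapsto\mathcal R(Z,X)Y\}$ is the Ricci tensor; the Ricci operator $\mathcal S$ is given by $g(\mathcal SX,Y)=S(X,Y)$; $\kappa=\mathrm{tr}\,\mathcal S$; $\mathcal C(X,Y)=\mathcal R(X,Y)-\frac{1}{n-2}\bigl(X\wedge_g\mathcal SY+\mathcal SX\wedge_gY-\frac{\kappa}{n-1}X\wedge_gY\bigr)$. The $(0,4)$-tensors are $G(X_1,X_2,X_3,X_4)=g((X_1\wedge_gX_2)X_3,X_4)$, $R(X_1,X_2,X_3,X_4)=g(\mathcal R(X_1,X_2)X_3,X_4)$, $C(X_1,X_2,X_3,X_4)=g(\mathcal C(X_1,X_2)X_3,X_4)$ (Weyl tensor). For $\mathcal B\in\{\mathcal R,\mathcal C\}$ with associated $(0,4)$-tensor $B\in\{R,C\}$ and a $(0,k)$-tensor $T$: $(B\cdot T)(X_1,\dots,X_k;X,Y)=-\sum_{i=1}^kT(X_1,\dots,\mathcal B(X,Y)X_i,\dots,X_k)$, and $Q(A,T)(X_1,\dots,X_k;X,Y)=-\sum_{i=1}^kT(X_1,\dots,(X\wedge_AY)X_i,\dots,X_k)$.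 A semi-Riemannian manifold is Einstein if its Ricci tensor equals (scalar curvature divided by dimension) times the metric at every point. The warped product $\overline M\times_F\widetilde N$ is $\overline M\times\widetilde N$ with metric $g=\pi_1^*\bar g+(F\circ\pi_1)\pi_2^*\tilde g$, $\pi_1,\pi_2$ being the projections; $x^1$ is the coordinate on $\overline M$ with $\bar g_{11}=\varepsilon$. $R,S,C$ refer to $g$; tensors with a tilde ($\widetilde R,\widetilde S,\widetilde G,\tilde\kappa$) are those of $(\widetilde N,\tilde g)$. Greek indices refer to the fiber, $\widetilde R_{\mu\beta\gamma\delta}=\widetilde R(\partial_\mu,\partial_\beta,\partial_\gamma,\partial_\delta)$, and $\widetilde S_\mu{}^\epsilon=\tilde g^{\epsilon\nu}\widetilde S_{\mu\nu}$. *)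

(* Defs.v *)
From HB Require Import structures.
From mathcomp Require Import all_boot all_order all_algebra.
From mathcomp Require Import all_classical all_reals all_analysis.
From mathcomp Require Import ring.
Set Implicit Arguments.
Unset Strict Implicit.
Unset Printing Implicit Defensive.
Import Order.TTheory GRing.Theory Num.Theory.
Import numFieldNormedType.Exports.
Local Open Scope classical_set_scope.
Local Open Scope ring_scope.

(* Points and vectors of R^n are row vectors; matrices act on the right. *)

Definition bvec (R : realType) (n : nat) (i : 'I_n) : 'rV[R]_n := delta_mx 0 i.

Definition partial (R : realType) (n : nat) (i : 'I_n) (f : 'rV[R]_n -> R)
    (x : 'rV[R]_n) : R :=
  'D_(bvec R i) f x.

Fixpoint Ck (R : realType) (n k : nat) (U : set 'rV[R]_n) (f : 'rV[R]_n -> R) :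
    Prop :=
  (forall x, U x -> {for x, continuous f}) /\
  (if k is k'.+1 then
     forall i, (forall x, U x -> derivable f x (bvec R i)) /\
               Ck k' U (partial i f)
   else True).

Definition smooth (R : realType) (n : nat) (U : set 'rV[R]_n)
    (f : 'rV[R]_n -> R) : Prop :=
  forall k, Ck k U f.

(* [jac t x] is the transpose of the usual Jacobian matrix: its [k]-th row is *)
(* the [k]-th partial derivative of [t]. *)
Definition jac (R : realType) (n m : nat) (t : 'rV[R]_n -> 'rV[R]_m)
    (x : 'rV[R]_n) : 'M[R]_(n, m) :=
  \matrix_(k, l) partial k (fun y => t y 0 l) x.

(* ------------------------------------------------------------------------ *)

Definition paracompact (T : topologicalType) : Prop :=
  forall C : set (set T),
    (forall U, C U -> open U) -> \bigcup_(U in C) U = setT ->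
    exists D : set (set T),
      [/\ forall V, D V -> open V,
          \bigcup_(V in D) V = setT,
          forall V, D V -> exists2 U, C U & V `<=` U
        & forall p : T, exists2 W : set T, nbhs p W &
            finite_set [set V | D V /\ V `&` W !=set0]].

(* [phi] and [psi] are total; only their restrictions to [dom] and [cod], *)
(* where they are inverse homeomorphisms, are meaningful. *)
Record chart (R : realType) (T : topologicalType) (n : nat) := Chart {
  dom : set T;
  cod : set 'rV[R]_n;
  phi : T -> 'rV[R]_n;
  psi : 'rV[R]_n -> T
}.

Definition is_chart (R : realType) (T : topologicalType) (n : nat)
    (c : chart R T n) : Prop :=
  [/\ open (dom c) /\ open (cod c),
      forall p, dom c p -> cod c (phi c p) /\ psi c (phi c p) = p,
      forall x, cod c x -> dom c (psi c x) /\ phi c (psi c x) = x,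
      forall p, dom c p -> {for p, continuous (phi c)}
    & forall x, cod c x -> {for x, continuous (psi c)}].

Definition overlap (R : realType) (T : topologicalType) (n : nat)
    (c d : chart R T n) : set 'rV[R]_n :=
  [set x | cod c x /\ dom d (psi c x)].

Definition transition (R : realType) (T : topologicalType) (n : nat)
    (c d : chart R T n) (x : 'rV[R]_n) : 'rV[R]_n :=
  phi d (psi c x).

Definition smooth_transition (R : realType) (T : topologicalType) (n : nat)
    (c d : chart R T n) : Prop :=
  forall l : 'I_n, smooth (overlap c d) (fun x => transition c d x 0 l).

(* The transformation law under a change of charts from [c] to [d], for a *)
(* (0,2)-tensor whose matrices of components are [g] and [h], respectively. *)
Definition tensor2_law (R : realType) (T : topologicalType) (n : nat)
    (c d : chart R T n) (g h : 'rV[R]_n -> 'M[R]_n) : Prop :=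
  forall x, overlap c d x ->
    g x = jac (transition c d) x *m h (transition c d x)
            *m (jac (transition c d) x)^T.

(* An atlas (not necessarily maximal), with the components of the metric in *)
(* each of its charts, as functions of the coordinates. *)
Record semiriem (R : realType) (n : nat) := SemiRiem {
  carrier : topologicalType;
  chart_index : Type;
  charts : chart_index -> chart R carrier n;
  metric : chart_index -> 'rV[R]_n -> 'M[R]_n
}.
Arguments charts {R n} s _.
Arguments metric {R n} s _ _.

Definition is_manifold (R : realType) (n : nat) (M : semiriem R n) : Prop :=
  [/\ hausdorff_space (carrier M), paracompact (carrier M),
      connected [set: carrier M] /\ [set: carrier M] !=set0,
      (forall p, exists i, dom (charts M i) p) /\
      (forall i, is_chart (charts M i))
    & forall i j, smooth_transition (charts M i) (charts M j)].

(* The index of the metric is not mentioned: it is constant since [M] is *)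
(* connected. *)
Definition is_semiriemannian (R : realType) (n : nat) (M : semiriem R n) :
    Prop :=
  [/\ is_manifold M,
      forall i k l, smooth (cod (charts M i)) (fun x => metric M i x k l),
      forall i x, cod (charts M i) x -> (metric M i x)^T = metric M i x,
      forall i x, cod (charts M i) x -> metric M i x \in unitmx
    & forall i j,
        tensor2_law (charts M i) (charts M j) (metric M i) (metric M j)].

(* [c] is a chart of the smooth structure of [M] (that is, of the maximal *)
(* atlas) in which the metric has components [h]. *)
Definition has_metric_in (R : realType) (n : nat) (M : semiriem R n)
    (c : chart R (carrier M) n) (h : 'rV[R]_n -> 'M[R]_n) : Prop :=
  is_chart c /\
  forall i, [/\ smooth_transition (charts M i) c,
                smooth_transition c (charts M i)
              & tensor2_law (charts M i) c (metric M i) h].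

(* ------------------------------------------------------------------------ *)
(* Geometry in one chart, of the metric with components [g]. *)

(* The symbol with upper index [k] and lower indices [i], [j]. *)
Definition christoffel (R : realType) (n : nat) (g : 'rV[R]_n -> 'M[R]_n)
    (x : 'rV[R]_n) (k i j : 'I_n) : R :=
  2%:R^-1 * \sum_l invmx (g x) k l *
    (partial i (fun y => g y j l) x + partial j (fun y => g y i l) x
     - partial l (fun y => g y i j) x).

(* The Levi-Civita connection on vector fields. *)
Definition nabla (R : realType) (n : nat) (g : 'rV[R]_n -> 'M[R]_n)
    (X Y : 'rV[R]_n -> 'rV[R]_n) (x : 'rV[R]_n) : 'rV[R]_n :=
  \row_k (\sum_i X x 0 i * partial i (fun y => Y y 0 k) x
          + \sum_i \sum_j christoffel g x k i j * X x 0 i * Y x 0 j).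

Definition bracket (R : realType) (n : nat) (X Y : 'rV[R]_n -> 'rV[R]_n)
    (x : 'rV[R]_n) : 'rV[R]_n :=
  \row_k \sum_i (X x 0 i * partial i (fun y => Y y 0 k) x
                 - Y x 0 i * partial i (fun y => X y 0 k) x).

Definition curv_field (R : realType) (n : nat) (g : 'rV[R]_n -> 'M[R]_n)
    (X Y Z : 'rV[R]_n -> 'rV[R]_n) (x : 'rV[R]_n) : 'rV[R]_n :=
  nabla g X (nabla g Y Z) x - nabla g Y (nabla g X Z) x
  - nabla g (bracket X Y) Z x.

(* Since [curv_field] is tensorial, its value on tangent vectors at [x] is *)
(* its value on any fields extending them, here the ones that are constant in *)
(* the chart. *)
Definition curv (R : realType) (n : nat) (g : 'rV[R]_n -> 'M[R]_n)
    (x u v w : 'rV[R]_n) : 'rV[R]_n :=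
  curv_field g (fun _ => u) (fun _ => v) (fun _ => w) x.

Definition gform (R : realType) (n : nat) (g : 'rV[R]_n -> 'M[R]_n)
    (x u v : 'rV[R]_n) : R :=
  (u *m g x *m v^T) 0 0.

Definition wedge (R : realType) (n : nat) (A : 'rV[R]_n -> 'rV[R]_n -> R)
    (u v w : 'rV[R]_n) : 'rV[R]_n :=
  A v w *: u - A u w *: v.

Definition ricci (R : realType) (n : nat) (g : 'rV[R]_n -> 'M[R]_n)
    (x u v : 'rV[R]_n) : R :=
  \tr (lin1_mx (fun z => curv g x z u v)).

(* The vector determined by g(ricci_op u, v) = ricci u v for all v. *)
Definition ricci_op (R : realType) (n : nat) (g : 'rV[R]_n -> 'M[R]_n)
    (x u : 'rV[R]_n) : 'rV[R]_n :=
  (\row_j ricci g x u (bvec R j)) *m invmx (g x).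

Definition scal (R : realType) (n : nat) (g : 'rV[R]_n -> 'M[R]_n)
    (x : 'rV[R]_n) : R :=
  \tr (lin1_mx (ricci_op g x)).

Definition weyl_op (R : realType) (n : nat) (g : 'rV[R]_n -> 'M[R]_n)
    (x u v w : 'rV[R]_n) : 'rV[R]_n :=
  curv g x u v w
  - (n%:R - 2%:R)^-1 *:
      (wedge (gform g x) u (ricci_op g x v) w
       + wedge (gform g x) (ricci_op g x u) v w
       - (scal g x / (n%:R - 1)) *: wedge (gform g x) u v w).

Definition tensor4 (R : realType) (n : nat) : Type :=
  'rV[R]_n -> 'rV[R]_n -> 'rV[R]_n -> 'rV[R]_n -> R.

Definition G4 (R : realType) (n : nat) (g : 'rV[R]_n -> 'M[R]_n)
    (x : 'rV[R]_n) : tensor4 R n :=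
  fun u1 u2 u3 u4 => gform g x (wedge (gform g x) u1 u2 u3) u4.

Definition R4 (R : realType) (n : nat) (g : 'rV[R]_n -> 'M[R]_n)
    (x : 'rV[R]_n) : tensor4 R n :=
  fun u1 u2 u3 u4 => gform g x (curv g x u1 u2 u3) u4.

Definition C4 (R : realType) (n : nat) (g : 'rV[R]_n -> 'M[R]_n)
    (x : 'rV[R]_n) : tensor4 R n :=
  fun u1 u2 u3 u4 => gform g x (weyl_op g x u1 u2 u3) u4.

(* [dot B T u1 u2 u3 u4 u v] is (B . T)(u1, u2, u3, u4; u, v). *)
Definition dot (R : realType) (n : nat)
    (B : 'rV[R]_n -> 'rV[R]_n -> 'rV[R]_n -> 'rV[R]_n) (T : tensor4 R n)
    (u1 u2 u3 u4 u v : 'rV[R]_n) : R :=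
  - (T (B u v u1) u2 u3 u4 + T u1 (B u v u2) u3 u4
     + T u1 u2 (B u v u3) u4 + T u1 u2 u3 (B u v u4)).

Definition Q (R : realType) (n : nat) (A : 'rV[R]_n -> 'rV[R]_n -> R)
    (T : tensor4 R n) : 'rV[R]_n -> 'rV[R]_n -> 'rV[R]_n -> 'rV[R]_n ->
                        'rV[R]_n -> 'rV[R]_n -> R :=
  dot (wedge A) T.

(* ------------------------------------------------------------------------ *)

Definition einstein (R : realType) (n : nat) (M : semiriem R n) : Prop :=
  forall (i : chart_index M) (x : 'rV[R]_n), cod (charts M i) x ->
  forall u v, ricci (metric M i) x u v
              = scal (metric M i) x / n%:R * gform (metric M i) x u v.

Definition constant_curvature (R : realType) (n : nat) (M : semiriem R n) :
    Prop :=
  exists c : R, forall (i : chart_index M) (x : 'rV[R]_n), cod (charts M i) x ->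
  forall u1 u2 u3 u4,
    R4 (metric M i) x u1 u2 u3 u4 = c * G4 (metric M i) x u1 u2 u3 u4.

Definition prod_chart (R : realType) (S T : topologicalType) (p q : nat)
    (c : chart R S p) (d : chart R T q) : chart R (S * T)%type (p + q) :=
  Chart [set z | dom c z.1 /\ dom d z.2]
        [set x | cod c (lsubmx x) /\ cod d (rsubmx x)]
        (fun z => row_mx (phi c z.1) (phi d z.2))
        (fun x => (psi c (lsubmx x), psi d (rsubmx x))).

Definition warped_product (R : realType) (p q : nat) (M : semiriem R p)
    (F : carrier M -> R) (N : semiriem R q) : semiriem R (p + q) :=
  SemiRiem
    (fun ij : chart_index M * chart_index N =>
       prod_chart (charts M ij.1) (charts N ij.2))
    (fun ij x =>
       block_mx (metric M ij.1 (lsubmx x)) 0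
                0 (F (psi (charts M ij.1) (lsubmx x)) *:
                     metric N ij.2 (rsubmx x))).

(* Around each point there is a coordinate x1 of the 1-manifold [M] in which *)
(* the metric is [eps] and [F] is (a x1 + b)^2. This covers both a global *)
(* coordinate and the circle, on which coordinates are only local. *)
Definition quadratic_warping (R : realType) (M : semiriem R 1) (eps a b : R)
    (F : carrier M -> R) : Prop :=
  forall p : carrier M, exists c : chart R (carrier M) 1,
    [/\ dom c p, has_metric_in c (fun _ => eps%:M)
      & forall q, dom c q -> F q = (a * phi c q 0 0 + b) ^+ 2].

(* ------------------------------------------------------------------------ *)

(* The Christoffel symbols are the only ones that define a torsion-free *)
(* connection for which the metric is parallel. *)
Lemma christoffelP (R : realType) (n : nat) (g : 'rV[R]_n -> 'M[R]_n)
    (x : 'rV[R]_n) (Gam : 'I_n -> 'I_n -> 'I_n -> R) :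
  g x \in unitmx -> (\forall y \near x, (g y)^T = g y) ->
  ((forall k i j, Gam k i j = Gam k j i) /\
   (forall k i j, partial k (fun y => g y i j) x
      = \sum_l (Gam l k i * g x l j + Gam l k j * g x i l)))
  <-> (forall k i j, Gam k i j = christoffel g x k i j).
Proof.
move=> gU gS.
have gx i j : g x i j = g x j i by rewrite -{1}(nbhs_singleton gS) mxE.
pose D k i j := partial k (fun y => g y i j) x.
have dS k i j : D k i j = D k j i.
  by apply: near_eq_derive; near=> y; rewrite -{1}(near gS y)// mxE.
have inv_l i j : \sum_l invmx (g x) i l * g x l j = (i == j)%:R.
  by have /matrixP/(_ i j) := mulVmx gU; rewrite !mxE.
have inv_r i j : \sum_l g x i l * invmx (g x) l j = (i == j)%:R.
  by have /matrixP/(_ i j) := mulmxV gU; rewrite !mxE.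
have two0 : (2%:R : R) != 0 by rewrite pnatr_eq0.
split=> [[Gs Gm] k i j|GE].
  pose L i j l := \sum_m Gam m i j * g x m l.
  have LS i' j' l : L i' j' l = L j' i' l.
    by apply: eq_bigr => m _; rewrite Gs.
  have DE k' i' j' : D k' i' j' = L k' i' j' + L k' j' i'.
    rewrite /D Gm big_split; congr (_ + _).
    by apply: eq_bigr => l _; rewrite gx.
  transitivity (\sum_l invmx (g x) k l * L i j l); last first.
    rewrite /christoffel mulr_sumr; apply: eq_bigr => l _.
    rewrite -!/(D _ _ _) !DE mulrCA; congr (_ * _).
    rewrite (LS j i) (LS l i) (LS l j).
    by field.
  under eq_bigr do rewrite mulr_sumr.
  rewrite exchange_big /= (bigD1 k)//= [X in _ + X]big1 ?addr0 => [|m mk].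
    under eq_bigr do rewrite mulrCA gx.
    by rewrite -mulr_sumr inv_l eqxx mulr1.
  under eq_bigr do rewrite mulrCA gx.
  by rewrite -mulr_sumr inv_l eq_sym (negPf mk) mulr0.
have low i j m : \sum_l Gam l i j * g x l m
    = 2%:R^-1 * (D i j m + D j i m - D m i j).
  transitivity (\sum_l \sum_p 2%:R^-1 * (D i j p + D j i p - D p i j)
                  * (g x m l * invmx (g x) l p)).
    apply: eq_bigr => l _; rewrite GE /christoffel -mulrA mulr_suml mulr_sumr.
    by apply: eq_bigr => p _; rewrite -!/(D _ _ _) gx; ring.
  rewrite exchange_big /= (bigD1 m)//= [X in _ + X]big1 ?addr0 => [|p pm].
    by rewrite -mulr_sumr inv_r eqxx mulr1.
  by rewrite -mulr_sumr inv_r eq_sym (negPf pm) mulr0.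
split=> [k i j|k i j].
  rewrite !GE /christoffel; congr (_ * _); apply: eq_bigr => l _.
  by rewrite -!/(D _ _ _) (dS l j i); congr (_ * (_ - _)); rewrite addrC.
rewrite big_split /= low.
under [X in _ + X]eq_bigr do rewrite gx.
rewrite low -/(D k i j) (dS k j i); rewrite (dS j k i) (dS j i k).
by rewrite (dS i k j); field.
Unshelve. all: by end_near. Qed.

(* Main.v *)
(* Let h and F be the components of the base metric and of the warping        *)
(* function in a chart of the base; F = (a x1 + b)^2 and h = eps (dx1)^2 give *)
(* F'^2 = 4 eps a^2 h F, in any coordinate. Under this relation all           *)
(* components of the curvature in the direction of the base vanish, while on  *)
(* the fiber the curvature operator is R~(X, Y) - eps a^2 (X /\ Y), with /\   *)
(* formed with g~, so that the Ricci tensor is lam g~, with eigenvalue        *)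
(* lam / F on the fiber. Hence (R - C)(X, Y) has the same fiber component as  *)
(* (X /\_S Y) / (n - 2), and R . (R - C) = 0 since R(X, Y) preserves both g   *)
(* and S. Therefore R . C - C . R = (R - C) . R = Q(S, R) / (n - 2). The      *)
(* skewness of the curvature of the fiber, used for R . g = R . S = 0, rests  *)
(* on the symmetry of second partial derivatives.                             *)

Require Import Defs.
From mathcomp Require Import all_boot all_order all_algebra.
From mathcomp Require Import all_classical all_reals all_analysis.
From mathcomp Require Import ring lra.
Set Implicit Arguments.
Unset Strict Implicit.
Unset Printing Implicit Defensive.
Import Order.TTheory GRing.Theory Num.Theory.
Import numFieldNormedType.Exports.
Local Open Scope classical_set_scope.
Local Open Scope ring_scope.

(** * Partial derivatives *)

(** Part (1) is linear algebra at a point. The Einstein condition makes the Ricci operator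
    kappa/(n-1) times the identity, which turns the left side into the first term on the right and
    makes the other two terms cancel.

    For part (2), a chart of the product splits each vector into a base and a fiber component, and
    the Levi-Civita connection is encoded as a matrix-valued one-form acting on row vectors. The
    connection of the warped metric is written down as a guess and confirmed by uniqueness
    ([conn_mx_unique], [conn_mx_warped]). Its curvature is then a block computation
    ([curv_mx_warped]). The warping function enters only through F'^2 = 4 c h F with c = eps a^2
    ([quadratic_warping_local]), which yields three identities between the connection coefficients
    ([base_partials]); under these only the fiber block survives.

    What remains is algebra at a point ([dot_curv_weyl]), and it rests on two facts. The Ricci
    operator is 0 on the base and a multiple rho of the identity on the fiber, and rho is also
    kappa/(n-1); hence the metric terms cancel in the fiber component of (n-2)(R - C)(X, Y), leaving
    that of the wedge of X and Y formed with S. Moreover R(X, Y) is skew with values in the fiber,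
    so as a derivation it kills the metric and the Ricci tensor, and with them R - C. *)

Section PartialDerivatives.
Context {R : realType} {n : nat}.
Implicit Types (f g : 'rV[R]_n -> R) (x u v : 'rV[R]_n).

Definition pderivable f x := forall i, derivable f x (bvec R i).

(** Taking the sum of partial derivatives, rather than the derivative along [u], makes linearity in
    [u] hold without total differentiability of [f]. *)
Definition dirder u f x := \sum_i u 0 i * partial i f x.

Lemma pderivable_cst c x : pderivable (fun=> c) x.
Proof. by move=> i; exact: derivable_cst. Qed.

Lemma pderivableD f g x :
  pderivable f x -> pderivable g x -> pderivable (fun y => f y + g y) x.
Proof. by move=> df dg i; exact: derivableD. Qed.

Lemma pderivableB f g x :
  pderivable f x -> pderivable g x -> pderivable (fun y => f y - g y) x.
Proof. by move=> df dg i; exact: derivableB. Qed.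

Lemma pderivableM f g x :
  pderivable f x -> pderivable g x -> pderivable (fun y => f y * g y) x.
Proof. by move=> df dg i; exact: derivableM. Qed.

Lemma pderivableV f x :
  f x != 0 -> pderivable f x -> pderivable (fun y => (f y)^-1) x.
Proof. by move=> fx df i; exact: derivableV. Qed.

Lemma pderivable_sum (I : Type) (r : seq I) (P : pred I)
    (h : I -> 'rV[R]_n -> R) x :
  (forall i, pderivable (h i) x) ->
  pderivable (fun y => \sum_(i <- r | P i) h i y) x.
Proof.
move=> dh; elim: r => [|i r IH].
  under eq_fun do rewrite big_nil; exact: pderivable_cst.
under eq_fun do rewrite big_cons; case: (P i); [exact: pderivableD (dh i) IH|exact: IH].
Qed.

Lemma pderivable_prod (I : Type) (r : seq I) (P : pred I)
    (h : I -> 'rV[R]_n -> R) x :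
  (forall i, pderivable (h i) x) ->
  pderivable (fun y => \prod_(i <- r | P i) h i y) x.
Proof.
move=> dh; elim: r => [|i r IH].
  under eq_fun do rewrite big_nil; exact: pderivable_cst.
under eq_fun do rewrite big_cons; case: (P i); [exact: pderivableM (dh i) IH|exact: IH].
Qed.

Lemma near_pderivable f g x :
  (\forall y \near x, f y = g y) -> pderivable f x -> pderivable g x.
Proof. by move=> fg df i; exact: near_eq_derivable (df i). Qed.

Lemma near_partial f g x i :
  (\forall y \near x, f y = g y) -> partial i f x = partial i g x.
Proof. exact: near_eq_derive. Qed.

Lemma partial_cst c x i : partial i (fun=> c) x = 0.
Proof. exact: derive_cst. Qed.

Lemma partialD f g x i : pderivable f x -> pderivable g x ->
  partial i (fun y => f y + g y) x = partial i f x + partial i g x.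
Proof. by move=> df dg; exact: deriveD. Qed.

Lemma partialM f g x i : pderivable f x -> pderivable g x ->
  partial i (fun y => f y * g y) x
  = partial i f x * g x + f x * partial i g x.
Proof.
move=> df dg; rewrite /partial (deriveM (df i) (dg i)) addrC.
by congr (_ + _); exact: mulrC.
Qed.

Lemma partialV f x i : f x != 0 -> pderivable f x ->
  partial i (fun y => (f y)^-1) x = - partial i f x / f x ^+ 2.
Proof.
by move=> fx df; rewrite /partial (deriveV fx (df i)) mulrC mulrN -mulNr.
Qed.

Lemma partial_sum (I : Type) (r : seq I) (P : pred I)
    (h : I -> 'rV[R]_n -> R) x i :
  (forall j, pderivable (h j) x) ->
  partial i (fun y => \sum_(j <- r | P j) h j y) x
  = \sum_(j <- r | P j) partial i (h j) x.
Proof.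
move=> dh; elim: r => [|j r IH].
  by under eq_fun do rewrite big_nil; rewrite partial_cst big_nil.
under eq_fun do rewrite big_cons; rewrite big_cons; case: (P j); last exact: IH.
by rewrite (partialD i (dh j) (@pderivable_sum _ r P _ _ dh)) IH.
Qed.

Lemma dirder_cst u c x : dirder u (fun=> c) x = 0.
Proof. by rewrite /dirder big1 // => i _; rewrite partial_cst mulr0. Qed.

Lemma near_dirder u f g x :
  (\forall y \near x, f y = g y) -> dirder u f x = dirder u g x.
Proof. by move=> fg; apply: eq_bigr => i _; rewrite (near_partial _ fg). Qed.

Lemma dirderD u f g x : pderivable f x -> pderivable g x ->
  dirder u (fun y => f y + g y) x = dirder u f x + dirder u g x.
Proof.
move=> df dg; rewrite /dirder -big_split; apply: eq_bigr => i _ /=.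
by rewrite partialD // mulrDr.
Qed.

Lemma dirderM u f g x : pderivable f x -> pderivable g x ->
  dirder u (fun y => f y * g y) x = dirder u f x * g x + f x * dirder u g x.
Proof.
move=> df dg; rewrite /dirder mulr_suml mulr_sumr -big_split.
by apply: eq_bigr => i _ /=; rewrite partialM //; ring.
Qed.

Lemma dirderMl u c f x : pderivable f x ->
  dirder u (fun y => c * f y) x = c * dirder u f x.
Proof.
by move=> df; rewrite (dirderM u (@pderivable_cst c x) df) dirder_cst mul0r add0r.
Qed.

Lemma dirderMr u c f x : pderivable f x ->
  dirder u (fun y => f y * c) x = dirder u f x * c.
Proof.
by move=> df; rewrite (dirderM u df (@pderivable_cst c x)) dirder_cst mulr0 addr0.
Qed.

Lemma dirder_sum u (I : Type) (r : seq I) (P : pred I)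
    (h : I -> 'rV[R]_n -> R) x :
  (forall j, pderivable (h j) x) ->
  dirder u (fun y => \sum_(j <- r | P j) h j y) x
  = \sum_(j <- r | P j) dirder u (h j) x.
Proof.
move=> dh; rewrite /dirder exchange_big; apply: eq_bigr => i _.
by rewrite partial_sum // mulr_sumr.
Qed.

Lemma dirderDl u v f x : dirder (u + v) f x = dirder u f x + dirder v f x.
Proof.
rewrite /dirder -big_split; apply: eq_bigr => i _ /=.
by rewrite !mxE mulrDl.
Qed.

Lemma dirderZl c u f x : dirder (c *: u) f x = c * dirder u f x.
Proof.
rewrite /dirder mulr_sumr; apply: eq_bigr => i _ /=.
by rewrite !mxE mulrA.
Qed.

Lemma is_derive_line f x v (t : R) : derivable f (x + t *: v) v ->
  is_derive t 1 (fun s : R => f (x + s *: v)) ('D_v f (x + t *: v)).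
Proof.
move=> df.
have E : (fun h : R => h^-1 *: ((fun s : R => f (x + s *: v)) (h *: 1 + t)
            - f (x + t *: v)))
       = (fun h : R => h^-1 *: (f (h *: v + (x + t *: v)) - f (x + t *: v))).
  apply/funext => h; congr (_ *: (f _ - _)).
  by rewrite scalerDl /GRing.scale /= mulr1 addrCA.
split; first by rewrite /derivable E.
by rewrite /derive E.
Qed.

Lemma mvt_line f x v (t : R) : 0 < t ->
  (forall s, 0 <= s <= t -> derivable f (x + s *: v) v) ->
  exists2 s, 0 < s < t & f (x + t *: v) - f x = 'D_v f (x + s *: v) * t.
Proof.
move=> t0 df.
have [||s] := @MVT R (fun s => f (x + s *: v)) (fun s => 'D_v f (x + s *: v)) 0 t t0.
- move=> s; rewrite in_itv /= => /andP[s0 st]; apply: is_derive_line.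
  by apply: df; rewrite !ltW.
- apply: derivable_within_continuous => s; rewrite in_itv /= => st.
  by have [] := is_derive_line (df s st).
by rewrite in_itv /= scale0r addr0 subr0 => st E; exists s.
Qed.

Lemma bvec_norm (i : 'I_n) (t : R) : `|t *: bvec R i| <= `|t|.
Proof.
rewrite normrZ ler_piMr //.
rewrite /Num.norm /= mx_normrE.
apply: bigmax_le => // -[a b] _ /=.
by rewrite mxE; case: (_ && _); rewrite ?normr1 ?normr0.
Qed.

(* The second difference of f over a small square is symmetric in the two     *)
(* directions, and by two applications of the mean value theorem it equals    *)
(* t^2 times a mixed derivative at a nearby point.                            *)
Lemma second_difference f x i j (r t : R) : 0 < t -> t + t < r ->
  (forall y, ball x r y -> pderivable f y /\ pderivable (partial i f) y) ->
  exists2 y, ball x r y &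
    f (x + t *: bvec R j + t *: bvec R i) - f (x + t *: bvec R j)
    - f (x + t *: bvec R i) + f x = partial j (partial i f) y * t * t.
Proof.
move=> t0 tr df.
have inball s s' : 0 <= s <= t -> 0 <= s' <= t ->
    ball x r (x + s *: bvec R i + s' *: bvec R j).
  move=> /andP[s0 st] /andP[s'0 s't].
  rewrite -ball_normE /= -addrA opprD addrA subrr add0r normrN.
  apply: le_lt_trans tr; apply: (le_trans (ler_normD _ _)); apply: lerD.
    by apply: (le_trans (bvec_norm _ _)); rewrite ger0_norm.
  by apply: (le_trans (bvec_norm _ _)); rewrite ger0_norm.
have tt : 0 <= t <= t by rewrite lexx ltW.
have t00 : 0 <= (0 : R) <= t by rewrite lexx ltW.
(* The second difference is the increment of [h] along direction [i]. The mean value theorem for [h]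
   turns it into an increment of [partial i f] along [j], to which the theorem is applied again. *)
pose h y := f (y + t *: bvec R j) - f y.
have dh s : 0 <= s <= t -> is_derive (x + s *: bvec R i) (bvec R i) h
   (partial i f (x + s *: bvec R i + t *: bvec R j) - partial i f (x + s *: bvec R i)).
  move=> st; have [d1 _] := df _ (inball s t st tt).
  have [] := df _ (inball s 0 st t00); rewrite scale0r addr0 => d2 _.
  have E : (fun k : R => k^-1 *: (f (k *: bvec R i + (x + s *: bvec R i) + t *: bvec R j) -
              f (x + s *: bvec R i + t *: bvec R j)))
         = (fun k : R => k^-1 *: (f (k *: bvec R i + (x + s *: bvec R i + t *: bvec R j)) -
              f (x + s *: bvec R i + t *: bvec R j))).
    by apply/funext => k; rewrite -!addrA.
  have D1 : is_derive (x + s *: bvec R i) (bvec R i)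
      (fun y => f (y + t *: bvec R j)) (partial i f (x + s *: bvec R i + t *: bvec R j)).
    split; first by rewrite /derivable /= E; exact: d1.
    by rewrite /derive /= E.
  have D2 : is_derive (x + s *: bvec R i) (bvec R i) f (partial i f (x + s *: bvec R i)).
    by split=> //; exact: d2.
  exact: is_deriveB.
have [s /andP[s0 st] E1] := @mvt_line h x (bvec R i) t t0
  (fun s st => let: DeriveDef d _ := dh s st in d).
have ss : 0 <= s <= t by rewrite !ltW.
have [_ E2] := dh s ss.
have [s' /andP[s'0 s't] E3] := @mvt_line (partial i f) (x + s *: bvec R i) (bvec R j) t t0
  (fun s' st => (df _ (inball s s' ss st)).2 j).
exists (x + s *: bvec R i + s' *: bvec R j).
  by apply: inball => //; rewrite !ltW.
rewrite -/(partial _ _ _) in E3.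
rewrite -E3 -E2 -E1 /h (addrAC x); ring.
Qed.

(** Schwarz's theorem. On a square of side [t] the two mixed derivatives, taken at suitable points
    [y] and [z], both equal the same second difference divided by t^2; continuity at [x] carries the
    equality over to [x] up to any [e]. *)
Lemma partial_comm f x i j :
  (\forall y \near x, pderivable f y) ->
  (\forall y \near x, pderivable (partial i f) y) ->
  (\forall y \near x, pderivable (partial j f) y) ->
  {for x, continuous (partial i (partial j f))} ->
  {for x, continuous (partial j (partial i f))} ->
  partial i (partial j f) x = partial j (partial i f) x.
Proof.
move=> d0 di dj ci cj.
apply/eqP; rewrite -subr_eq0 -normr_le0; apply/ler_addgt0Pl => e e0.
rewrite addr0.
have e2 : 0 < e / 2 by rewrite divr_gt0.
have [r r0 H] : exists2 r : R, 0 < r & forall y, ball x r y ->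
  [/\ pderivable f y, pderivable (partial i f) y, pderivable (partial j f) y,
    `|partial i (partial j f) x - partial i (partial j f) y| < e / 2 &
    `|partial j (partial i f) x - partial j (partial i f) y| < e / 2].
  move/cvgr_dist_lt: ci => /(_ _ e2) ci'; move/cvgr_dist_lt: cj => /(_ _ e2) cj'.
  have [r r0 rH] := (nbhs_ballP x _).1
    (filterI d0 (filterI di (filterI dj (filterI ci' cj')))).
  exists r => // y /rH.
  by case=> a1 [a2 [a3 [a4 a5]]]; exact: And5 a1 a2 a3 a4 a5.
pose t := r / 3.
have t0 : 0 < t by rewrite divr_gt0.
have tr : t + t < r by rewrite /t; lra.
have [y /H[_ _ _ _ y2] yE] := @second_difference f x i j r t t0 tr
  (fun y yb => let: And5 a b _ _ _ := H y yb in conj a b).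
have [z /H[_ _ _ z2 _] zE] := @second_difference f x j i r t t0 tr
  (fun y yb => let: And5 a _ b _ _ := H y yb in conj a b).
have E : partial j (partial i f) y = partial i (partial j f) z.
  have cancel_sq A B c d : A = c * t * t -> B = d * t * t -> A = B -> c = d.
    by move=> -> -> /(mulIf (lt0r_neq0 t0)) /(mulIf (lt0r_neq0 t0)).
  by apply: (cancel_sq _ _ _ _ yE zE); rewrite (addrAC x); ring.
have -> : partial i (partial j f) x - partial j (partial i f) x =
   (partial i (partial j f) x - partial i (partial j f) z)
   - (partial j (partial i f) x - partial j (partial i f) y).
  by rewrite E opprB addrA subrK.
apply: (le_trans (ler_normB _ _)); rewrite (splitr e).
exact: lerD (ltW z2) (ltW y2).
Qed.

Lemma pderivable_det m (A : 'rV[R]_n -> 'M[R]_m) x :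
  (forall i j, pderivable (fun y => A y i j) x) ->
  pderivable (fun y => \det (A y)) x.
Proof.
move=> dA; apply: pderivable_sum => s; apply: pderivableM.
  exact: pderivable_cst.
by apply: pderivable_prod => i; exact: dA.
Qed.

(** By Cramer's rule the entries of the inverse are cofactors divided by the determinant. [invmx]
    has this form only on invertible matrices, hence the assumption on a neighbourhood. *)
Lemma pderivable_invmx m (A : 'rV[R]_n -> 'M[R]_m) x :
  (\forall y \near x, A y \in unitmx) ->
  (forall i j, pderivable (fun y => A y i j) x) ->
  forall i j, pderivable (fun y => invmx (A y) i j) x.
Proof.
move=> Au dA i j.
apply: (@near_pderivable (fun y => (\det (A y))^-1 * cofactor (A y) j i)).
  by near=> y; rewrite /invmx (near Au y) // !mxE.
apply: pderivableM.
  apply: pderivableV; last exact: pderivable_det.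
  by have := nbhs_singleton Au; rewrite unitmxE unitfE.
rewrite /cofactor; apply: pderivableM; first exact: pderivable_cst.
apply: pderivable_det => k l.
by under eq_fun do rewrite !mxE; exact: dA.
Unshelve. all: by end_near. Qed.

End PartialDerivatives.

(** * The Levi-Civita connection and its curvature *)

Section MatrixFields.
Context {R : realType} {n : nat}.
Implicit Types (x u v : 'rV[R]_n).

Definition mxderivable p q (A : 'rV[R]_n -> 'M[R]_(p, q)) x :=
  forall i j, pderivable (fun y => A y i j) x.

Definition mxdirder p q u (A : 'rV[R]_n -> 'M[R]_(p, q)) x : 'M[R]_(p, q) :=
  \matrix_(i, j) dirder u (fun y => A y i j) x.

Lemma near_mxderivable p q (A B : 'rV[R]_n -> 'M[R]_(p, q)) x :
  (\forall y \near x, A y = B y) -> mxderivable A x -> mxderivable B x.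
Proof.
move=> AB dA i j; apply: near_pderivable (dA i j).
by apply: filterS AB => y ->.
Qed.

Lemma near_mxdirder p q u (A B : 'rV[R]_n -> 'M[R]_(p, q)) x :
  (\forall y \near x, A y = B y) -> mxdirder u A x = mxdirder u B x.
Proof.
move=> AB; apply/matrixP => i j; rewrite !mxE; apply: near_dirder.
by apply: filterS AB => y ->.
Qed.

Lemma mxderivable_cst p q (A : 'M[R]_(p, q)) x : mxderivable (fun=> A) x.
Proof. by move=> i j; exact: pderivable_cst. Qed.

Lemma mxderivableD p q (A B : 'rV[R]_n -> 'M[R]_(p, q)) x :
  mxderivable A x -> mxderivable B x -> mxderivable (fun y => A y + B y) x.
Proof.
move=> dA dB i j; under eq_fun do rewrite mxE.
exact: pderivableD (dA i j) (dB i j).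
Qed.

Lemma mxderivableM p q r (A : 'rV[R]_n -> 'M[R]_(p, q))
    (B : 'rV[R]_n -> 'M[R]_(q, r)) x :
  mxderivable A x -> mxderivable B x -> mxderivable (fun y => A y *m B y) x.
Proof.
move=> dA dB i j; under eq_fun do rewrite mxE.
apply: pderivable_sum => k; exact: pderivableM (dA i k) (dB k j).
Qed.

Lemma mxderivable_tr p q (A : 'rV[R]_n -> 'M[R]_(p, q)) x :
  mxderivable A x -> mxderivable (fun y => (A y)^T) x.
Proof. by move=> dA i j; under eq_fun do rewrite mxE; exact: dA. Qed.

Lemma mxdirder_cst p q u (A : 'M[R]_(p, q)) x : mxdirder u (fun=> A) x = 0.
Proof. by apply/matrixP => i j; rewrite !mxE dirder_cst. Qed.

Lemma mxdirderD p q u (A B : 'rV[R]_n -> 'M[R]_(p, q)) x :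
  mxderivable A x -> mxderivable B x ->
  mxdirder u (fun y => A y + B y) x = mxdirder u A x + mxdirder u B x.
Proof.
move=> dA dB; apply/matrixP => i j; rewrite !mxE.
under eq_fun do rewrite mxE.
exact: dirderD (dA i j) (dB i j).
Qed.

Lemma mxdirderM p q r u (A : 'rV[R]_n -> 'M[R]_(p, q))
    (B : 'rV[R]_n -> 'M[R]_(q, r)) x :
  mxderivable A x -> mxderivable B x ->
  mxdirder u (fun y => A y *m B y) x
  = mxdirder u A x *m B x + A x *m mxdirder u B x.
Proof.
move=> dA dB; apply/matrixP => i j; rewrite !mxE.
under eq_fun do rewrite mxE.
rewrite dirder_sum => [|k]; last exact: pderivableM (dA i k) (dB k j).
rewrite -big_split; apply: eq_bigr => k _.
by rewrite (dirderM u (dA i k) (dB k j)) !mxE.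
Qed.

Lemma mxdirder_tr p q u (A : 'rV[R]_n -> 'M[R]_(p, q)) x :
  mxdirder u (fun y => (A y)^T) x = (mxdirder u A x)^T.
Proof.
by apply/matrixP => i j; rewrite !mxE; under eq_fun do rewrite mxE.
Qed.

Lemma mxdirderMl p q r u (A : 'M[R]_(p, q))
    (B : 'rV[R]_n -> 'M[R]_(q, r)) x :
  mxderivable B x ->
  mxdirder u (fun y => A *m B y) x = A *m mxdirder u B x.
Proof.
move=> dB; rewrite (mxdirderM u (@mxderivable_cst _ _ A x) dB).
by rewrite mxdirder_cst mul0mx add0r.
Qed.

Lemma mxdirderMr p q r u (A : 'M[R]_(q, r))
    (B : 'rV[R]_n -> 'M[R]_(p, q)) x :
  mxderivable B x ->
  mxdirder u (fun y => B y *m A) x = mxdirder u B x *m A.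
Proof.
move=> dB; rewrite (mxdirderM u dB (@mxderivable_cst _ _ A x)).
by rewrite mxdirder_cst mulmx0 addr0.
Qed.

Lemma mxderivableZ p q c (A : 'rV[R]_n -> 'M[R]_(p, q)) x :
  mxderivable A x -> mxderivable (fun y => c *: A y) x.
Proof.
move=> dA i j; under eq_fun do rewrite mxE.
exact: pderivableM (@pderivable_cst _ _ _ _) (dA i j).
Qed.

Lemma mxdirderZ p q c u (A : 'rV[R]_n -> 'M[R]_(p, q)) x :
  mxderivable A x -> mxdirder u (fun y => c *: A y) x = c *: mxdirder u A x.
Proof.
move=> dA; apply/matrixP => i j; rewrite !mxE; under eq_fun do rewrite mxE.
exact: dirderMl (dA i j).
Qed.

Lemma mxdirderDl p q u v (A : 'rV[R]_n -> 'M[R]_(p, q)) x :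
  mxdirder (u + v) A x = mxdirder u A x + mxdirder v A x.
Proof. by apply/matrixP => i j; rewrite !mxE dirderDl. Qed.

Lemma mxdirderZl p q c u (A : 'rV[R]_n -> 'M[R]_(p, q)) x :
  mxdirder (c *: u) A x = c *: mxdirder u A x.
Proof. by apply/matrixP => i j; rewrite !mxE dirderZl. Qed.

(** Both sides expand into double sums of second partial derivatives, which agree termwise by
    [partial_comm]. *)
Lemma mxdirder_comm u v p q (A : 'rV[R]_n -> 'M[R]_(p, q)) (V : set 'rV[R]_n) x :
  open V -> V x -> (forall i j, Ck 2 V (fun y => A y i j)) ->
  mxdirder u (fun y => mxdirder v A y) x
  = mxdirder v (fun y => mxdirder u A y) x.
Proof.
move=> Vo Vx CA; apply/matrixP => i j; rewrite !mxE.
under eq_fun do rewrite mxE; under [in RHS]eq_fun do rewrite mxE.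
set f := fun y => A y i j.
have [_ Cf] := CA i j; rewrite -/f in Cf.
have d0 y : V y -> pderivable f y by move=> Vy k; apply: (Cf k).1.
have d1 k y : V y -> pderivable (partial k f) y.
  by move=> Vy l; have [_ [_ /(_ l)[+ _]]] := Cf k; apply.
have c2 k l : {for x, continuous (partial l (partial k f))}.
  by have [_ [_ /(_ l)[_ [+ _]]]] := Cf k; apply.
have nV (P : set 'rV[R]_n) : (forall y, V y -> P y) -> \forall y \near x, P y.
  move=> VP; apply: filterS VP _; exact: open_nbhs_nbhs.
have dM k w y : V y -> pderivable (fun y => w 0 k * partial k f y) y.
  by move=> Vy; exact: pderivableM (@pderivable_cst _ _ _ _) (d1 _ _ Vy).
have dd a b : dirder a (fun y => dirder b f y) x
  = \sum_k \sum_l a 0 l * b 0 k * partial l (partial k f) x.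
  rewrite dirder_sum => [|k]; last exact: dM.
  apply: eq_bigr => k _; rewrite (dirderMl _ _ (d1 k x Vx)) mulr_sumr.
  by apply: eq_bigr => l _; rewrite mulrCA mulrA.
have pc k l : partial k (partial l f) x = partial l (partial k f) x.
  by apply: partial_comm (c2 _ _) (c2 _ _); apply: nV; [exact: d0|exact: d1|exact: d1].
rewrite !dd exchange_big; apply: eq_bigr => k _; apply: eq_bigr => l _.
exact: (congr2 *%R (mulrC (u 0 k) (v 0 l)) (pc k l)).
Qed.

End MatrixFields.

(** Products and derivatives become opaque atoms; what is left is an identity in an additive group
    of matrices, checked entrywise. *)
Ltac mx_abelian :=
  repeat match goal with
  | |- context [mulmx ?A ?B] => let z := fresh "z" in move: (mulmx A B) => z
  | |- context [mxdirder ?u ?A ?x] => let z := fresh "z" in move: (mxdirder u A x) => z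
  end;
  apply/matrixP => ? ?; rewrite !mxE; ring.

Section LeviCivita.
Context {R : realType} {n : nat}.
Implicit Types (g : 'rV[R]_n -> 'M[R]_n) (x u v w : 'rV[R]_n).

(* The matrix of the endomorphism w |-> Gamma(u, w), acting on row vectors. *)
Definition conn_mx g x u : 'M[R]_n :=
  \matrix_(j, k) \sum_i u 0 i * christoffel g x k i j.

(** The curvature two-form of the connection form, evaluated on constant fields. Matrices act on row
    vectors from the right, so products come in the order opposite to that of the covariant
    derivatives. *)
Definition curv_mx g x u v : 'M[R]_n :=
  mxdirder u (fun y => conn_mx g y v) x + conn_mx g x v *m conn_mx g x u
  - (mxdirder v (fun y => conn_mx g y u) x + conn_mx g x u *m conn_mx g x v).

Lemma conn_mxD g x u v : conn_mx g x (u + v) = conn_mx g x u + conn_mx g x v.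
Proof.
apply/matrixP => j k; rewrite !mxE -big_split; apply: eq_bigr => i _.
by rewrite mxE mulrDl.
Qed.

Lemma conn_mxZ g x c u : conn_mx g x (c *: u) = c *: conn_mx g x u.
Proof.
apply/matrixP => j k; rewrite !mxE mulr_sumr; apply: eq_bigr => i _.
by rewrite mxE mulrA.
Qed.

Lemma nablaE g (X Y : 'rV[R]_n -> 'rV[R]_n) x :
  nabla g X Y x = mxdirder (X x) Y x + Y x *m conn_mx g x (X x).
Proof.
apply/rowP => k; rewrite !mxE; congr (_ + _).
rewrite exchange_big; apply: eq_bigr => j _ /=.
rewrite !mxE mulr_sumr; apply: eq_bigr => i _.
by rewrite mulrC; congr (_ * _); exact: mulrC.
Qed.

Lemma mxdirder_bvec p q (A : 'rV[R]_n -> 'M[R]_(p, q)) x i a b :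
  mxdirder (bvec R i) A x a b = partial i (fun y => A y a b) x.
Proof.
rewrite mxE /dirder (bigD1 i) //= big1 ?addr0 => [|l li].
  by rewrite mxE !eqxx mul1r.
by rewrite mxE (negPf li) mul0r.
Qed.

Lemma conn_mx_torsion g x u v :
  g x \in unitmx -> (\forall y \near x, (g y)^T = g y) ->
  v *m conn_mx g x u = u *m conn_mx g x v.
Proof.
move=> gU gS.
have [sym _] := (christoffelP (christoffel g x) gU gS).2 (fun _ _ _ => erefl).
apply/rowP => k; rewrite !mxE.
under eq_bigr do rewrite mxE mulr_sumr; under [RHS]eq_bigr do rewrite mxE mulr_sumr.
rewrite exchange_big; apply: eq_bigr => i _; apply: eq_bigr => j _.
by rewrite mulrCA (sym k i j).
Qed.

Lemma conn_mx_metric g x u :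
  g x \in unitmx -> (\forall y \near x, (g y)^T = g y) ->
  mxdirder u g x = conn_mx g x u *m g x + g x *m (conn_mx g x u)^T.
Proof.
move=> gU gS.
have [_ met] := (christoffelP (christoffel g x) gU gS).2 (fun _ _ _ => erefl).
apply/matrixP => i j; rewrite !mxE /dirder.
under eq_bigr do rewrite met mulr_sumr.
rewrite exchange_big -big_split; apply: eq_bigr => l _ /=.
rewrite !mxE mulr_suml mulr_sumr -big_split; apply: eq_bigr => k _ /=.
by ring.
Qed.

(** Uniqueness of the Levi-Civita connection in matrix form: a guessed connection can be verified
    without computing any Christoffel symbol. By linearity it is enough to compare the two on basis
    vectors. *)
Lemma conn_mx_unique g x (A : 'rV[R]_n -> 'M[R]_n) :
  g x \in unitmx -> (\forall y \near x, (g y)^T = g y) ->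
  (forall c u v, A (c *: u + v) = c *: A u + A v) ->
  (forall u v, v *m A u = u *m A v) ->
  (forall u, mxdirder u g x = A u *m g x + g x *m (A u)^T) ->
  forall u, conn_mx g x u = A u.
Proof.
move=> gU gS Alin tor met u.
have bmulE i (B : 'M[R]_n) j : (bvec R i *m B) 0 j = B i j.
  by rewrite -rowE mxE.
have E := (christoffelP (fun k i j => A (bvec R i) j k) gU gS).1.
have A0 : A 0 = 0 by move/eqP: (Alin 1 0 0); rewrite !scale1r addr0 -subr_eq subrr => /eqP.
have -> : A u = \sum_i u 0 i *: A (bvec R i).
  rewrite {1}(row_sum_delta u).
  by elim/big_rec2: _ => // i B w _ <-.
apply/matrixP => j k; rewrite mxE summxE.
apply: eq_bigr => i _; rewrite mxE -E //; split=> [{}k {}i {}j|{}k {}i {}j].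
  by rewrite -!bmulE tor.
rewrite -mxdirder_bvec met !mxE -big_split; apply: eq_bigr => l _ /=.
by rewrite mxE; congr (_ + _); exact: mulrC.
Qed.

Lemma curvE g x u v w :
  (forall u, mxderivable (fun y => conn_mx g y u) x) ->
  curv g x u v w = w *m curv_mx g x u v.
Proof.
move=> dA.
have nC X y : nabla g X (fun=> w) y = w *m conn_mx g y (X y).
  by rewrite nablaE mxdirder_cst add0r.
have nCC a b : nabla g (fun=> a) (nabla g (fun=> b) (fun=> w)) x
    = w *m (mxdirder a (fun y => conn_mx g y b) x
            + conn_mx g x b *m conn_mx g x a).
  have -> : nabla g (fun=> b) (fun=> w) = fun y => w *m conn_mx g y b.
    by apply/funext => y; rewrite nC.
  by rewrite nablaE (mxdirderMl a w (dA b)) mulmxDr mulmxA.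
(* Constant fields commute; zero is written [0 *: u] so that [conn_mxZ] removes the bracket term. *)
have br0 : bracket (fun=> u) (fun=> v) x = 0 *: u.
  rewrite scale0r; apply/rowP => k; rewrite !mxE big1 // => i _.
  by rewrite !partial_cst !mulr0 subr0.
by rewrite /curv /curv_field !nCC nC br0 conn_mxZ scale0r mulmx0 subr0 -mulmxBr.
Qed.

Lemma curv_mxC g x u v : curv_mx g x v u = - curv_mx g x u v.
Proof. by rewrite /curv_mx opprB. Qed.

Lemma curv_mx_linear g x c u u' v :
  (forall u, mxderivable (fun y => conn_mx g y u) x) ->
  curv_mx g x (c *: u + u') v = c *: curv_mx g x u v + curv_mx g x u' v.
Proof.
move=> dA; rewrite /curv_mx.
have -> : (fun y => conn_mx g y (c *: u + u'))
        = fun y => c *: conn_mx g y u + conn_mx g y u'.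
  by apply/funext => y; rewrite conn_mxD conn_mxZ.
rewrite (mxdirderD v (@mxderivableZ _ _ _ _ c _ _ (dA u)) (dA u')) (mxdirderZ c v (dA u)).
rewrite mxdirderDl mxdirderZl conn_mxD conn_mxZ.
rewrite mulmxDr mulmxDl -scalemxAl -scalemxAr.
by mx_abelian.
Qed.

Section SmoothMetric.
Variables (g : 'rV[R]_n -> 'M[R]_n) (V : set 'rV[R]_n).
Hypothesis Vo : open V.
Hypothesis gS : forall y, V y -> (g y)^T = g y.
Hypothesis gU : forall y, V y -> g y \in unitmx.
Hypothesis gC : forall i j, Ck 2 V (fun y => g y i j).

Let nearV (P : 'rV[R]_n -> Prop) x :
  V x -> (forall y, V y -> P y) -> \forall y \near x, P y.
Proof. by move=> Vx VP; apply: filterS VP _; exact: open_nbhs_nbhs. Qed.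

Lemma metric_mxderivable x : V x -> mxderivable g x.
Proof. by move=> Vx i j k; have [_ Cf] := gC i j; exact: (Cf k).1. Qed.

Lemma metric_partial_derivable x i j k :
  V x -> pderivable (partial k (fun y => g y i j)) x.
Proof.
by move=> Vx l; have [_ /(_ k)[_ [_ /(_ l)[+ _]]]] := gC i j; exact.
Qed.

Lemma conn_mx_derivable x u : V x -> mxderivable (fun y => conn_mx g y u) x.
Proof.
move=> Vx j k.
have dI : mxderivable (fun y => invmx (g y)) x.
  exact: pderivable_invmx (nearV Vx gU) (metric_mxderivable Vx).
under eq_fun do rewrite mxE.
apply: pderivable_sum => i; apply: pderivableM (@pderivable_cst _ _ _ _) _.
apply: pderivableM (@pderivable_cst _ _ _ _) _.
apply: pderivable_sum => l; apply: pderivableM (dI k l) _.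
apply: pderivableB; last exact: metric_partial_derivable.
by apply: pderivableD; exact: metric_partial_derivable.
Qed.

(** Differentiate the equation that the metric is parallel once more and antisymmetrize in [u] and
    [v]: second derivatives of [g] commute, and what remains is the skewness of the curvature. *)
Lemma curv_mx_skew x u v : V x ->
  curv_mx g x u v *m g x + g x *m (curv_mx g x u v)^T = 0.
Proof.
move=> Vx.
have dg := metric_mxderivable Vx.
have dA a := @conn_mx_derivable x a Vx.
have met a y : V y -> mxdirder a g y = conn_mx g y a *m g y + g y *m (conn_mx g y a)^T.
  by move=> Vy; exact: conn_mx_metric (gU Vy) (nearV Vy gS).
(* The last bracket is symmetric in [a] and [b], so it drops out on antisymmetrizing. *)
have E a b : mxdirder a (fun y => mxdirder b g y) x =
    (mxdirder a (fun y => conn_mx g y b) x + conn_mx g x b *m conn_mx g x a) *m g x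
    + g x *m (mxdirder a (fun y => conn_mx g y b) x + conn_mx g x b *m conn_mx g x a)^T
    + (conn_mx g x b *m g x *m (conn_mx g x a)^T + conn_mx g x a *m g x *m (conn_mx g x b)^T).
  rewrite (near_mxdirder a (nearV Vx (met b))).
  have dAb := mxderivable_tr (dA b).
  rewrite (mxdirderD a (mxderivableM (dA b) dg) (mxderivableM dg dAb)).
  rewrite (mxdirderM a (dA b) dg) (mxdirderM a dg dAb) mxdirder_tr met //.
  rewrite [(_ + _)^T]linearD /= trmx_mul !(mulmxDl, mulmxDr, mulmxA).
  by mx_abelian.
have /eqP := mxdirder_comm u v Vo Vx gC; rewrite -subr_eq0 => /eqP.
rewrite !E /curv_mx [(_ - _)^T]linearB /= !(mulmxBl, mulmxBr) => <-.
by mx_abelian.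
Qed.

End SmoothMetric.

End LeviCivita.

(** * Derivatives of functions pulled back along linear maps, and of block matrices *)

Section LinearSubstitution.
Context {R : realType}.

(** For linear [L] the two difference quotients are the same function, so this chain rule holds even
    where the derivative does not exist. *)
Lemma derive_linear m n (L : {linear 'rV[R]_m -> 'rV[R]_n})
    (f : 'rV[R]_n -> R) x v :
  'D_v (fun y => f (L y)) x = 'D_(L v) f (L x).
Proof.
have E : (fun h : R => h^-1 *: (f (L (h *: v + x)) - f (L x)))
       = (fun h : R => h^-1 *: (f (h *: L v + L x) - f (L x))).
  by apply/funext => h; rewrite linearP.
by rewrite /derive /= E.
Qed.

Lemma derivable_linear m n (L : {linear 'rV[R]_m -> 'rV[R]_n})
    (f : 'rV[R]_n -> R) x v :
  derivable f (L x) (L v) -> derivable (fun y => f (L y)) x v.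
Proof.
have E : (fun h : R => h^-1 *: (f (L (h *: v + x)) - f (L x)))
       = (fun h : R => h^-1 *: (f (h *: L v + L x) - f (L x))).
  by apply/funext => h; rewrite linearP.
by rewrite /derivable /= E.
Qed.

Lemma lsubmx_bvecl p q (i : 'I_p) :
  lsubmx (bvec R (lshift q i)) = bvec R i.
Proof. by apply/rowP => j; rewrite !mxE eq_lshift. Qed.

Lemma lsubmx_bvecr p q (i : 'I_q) : lsubmx (bvec R (rshift p i)) = 0.
Proof. by apply/rowP => j; rewrite !mxE eq_lrshift. Qed.

Lemma rsubmx_bvecl p q (i : 'I_p) : rsubmx (bvec R (lshift q i)) = 0.
Proof. by apply/rowP => j; rewrite !mxE eq_rlshift. Qed.

Lemma rsubmx_bvecr p q (i : 'I_q) :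
  rsubmx (bvec R (rshift p i)) = bvec R i.
Proof. by apply/rowP => j; rewrite !mxE eq_rshift. Qed.

Lemma pderivable_lsubmx p q (f : 'rV[R]_p -> R) (z : 'rV[R]_(p + q)) :
  pderivable f (lsubmx z) -> pderivable (fun y => f (lsubmx y)) z.
Proof.
move=> df k; apply: derivable_linear; case: (split_ordP k) => i -> /=.
  by rewrite lsubmx_bvecl; exact: df.
by rewrite lsubmx_bvecr; exact: derivable0.
Qed.

Lemma pderivable_rsubmx p q (f : 'rV[R]_q -> R) (z : 'rV[R]_(p + q)) :
  pderivable f (rsubmx z) -> pderivable (fun y => f (rsubmx y)) z.
Proof.
move=> df k; apply: derivable_linear; case: (split_ordP k) => i -> /=.
  by rewrite rsubmx_bvecl; exact: derivable0.
by rewrite rsubmx_bvecr; exact: df.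
Qed.

Lemma dirder_lsubmx p q u (f : 'rV[R]_p -> R) (z : 'rV[R]_(p + q)) :
  dirder u (fun y => f (lsubmx y)) z = dirder (lsubmx u) f (lsubmx z).
Proof.
rewrite /dirder big_split_ord /= [X in _ + X]big1 => [|i _].
  rewrite addr0; apply: eq_bigr => i _.
  by rewrite mxE; congr (_ * _); rewrite /partial derive_linear /= lsubmx_bvecl.
by rewrite /partial derive_linear /= lsubmx_bvecr derive0 mulr0.
Qed.

Lemma dirder_rsubmx p q u (f : 'rV[R]_q -> R) (z : 'rV[R]_(p + q)) :
  dirder u (fun y => f (rsubmx y)) z = dirder (rsubmx u) f (rsubmx z).
Proof.
rewrite /dirder big_split_ord /= big1 => [|i _].
  rewrite add0r; apply: eq_bigr => i _.
  by rewrite mxE; congr (_ * _); rewrite /partial derive_linear /= rsubmx_bvecr.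
by rewrite /partial derive_linear /= rsubmx_bvecl derive0 mulr0.
Qed.

End LinearSubstitution.

Section BlockFields.
Context {R : realType} {n : nat}.
Implicit Types (x u : 'rV[R]_n).

Lemma mxderivable_block p1 p2 q1 q2 (A : 'rV[R]_n -> 'M[R]_(p1, q1))
    (B : 'rV[R]_n -> 'M[R]_(p1, q2)) (C : 'rV[R]_n -> 'M[R]_(p2, q1))
    (D : 'rV[R]_n -> 'M[R]_(p2, q2)) x :
  mxderivable A x -> mxderivable B x -> mxderivable C x -> mxderivable D x ->
  mxderivable (fun y => block_mx (A y) (B y) (C y) (D y)) x.
Proof.
move=> dA dB dC dD i j.
case: (split_ordP i) => a ->; case: (split_ordP j) => b ->.
- by under eq_fun do rewrite block_mxEul; exact: dA.
- by under eq_fun do rewrite block_mxEur; exact: dB.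
- by under eq_fun do rewrite block_mxEdl; exact: dC.
- by under eq_fun do rewrite block_mxEdr; exact: dD.
Qed.

Lemma mxdirder_block p1 p2 q1 q2 u (A : 'rV[R]_n -> 'M[R]_(p1, q1))
    (B : 'rV[R]_n -> 'M[R]_(p1, q2)) (C : 'rV[R]_n -> 'M[R]_(p2, q1))
    (D : 'rV[R]_n -> 'M[R]_(p2, q2)) x :
  mxdirder u (fun y => block_mx (A y) (B y) (C y) (D y)) x
  = block_mx (mxdirder u A x) (mxdirder u B x) (mxdirder u C x) (mxdirder u D x).
Proof.
apply/matrixP => i j; rewrite mxE.
case: (split_ordP i) => a ->; case: (split_ordP j) => b ->.
- by under eq_fun do rewrite block_mxEul; rewrite block_mxEul mxE.
- by under eq_fun do rewrite block_mxEur; rewrite block_mxEur mxE.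
- by under eq_fun do rewrite block_mxEdl; rewrite block_mxEdl mxE.
- by under eq_fun do rewrite block_mxEdr; rewrite block_mxEdr mxE.
Qed.

Lemma mxderivable_scale p q (f : 'rV[R]_n -> R) (A : 'rV[R]_n -> 'M[R]_(p, q)) x :
  pderivable f x -> mxderivable A x -> mxderivable (fun y => f y *: A y) x.
Proof.
move=> df dA i j; under eq_fun do rewrite mxE.
exact: pderivableM df (dA i j).
Qed.

Lemma mxdirder_scale p q u (f : 'rV[R]_n -> R) (A : 'rV[R]_n -> 'M[R]_(p, q)) x :
  pderivable f x -> mxderivable A x ->
  mxdirder u (fun y => f y *: A y) x
  = dirder u f x *: A x + f x *: mxdirder u A x.
Proof.
move=> df dA; apply/matrixP => i j; rewrite !mxE; under eq_fun do rewrite mxE.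
exact: dirderM df (dA i j).
Qed.

Lemma mxderivable_scalar p (f : 'rV[R]_n -> R) x :
  pderivable f x -> mxderivable (fun y => (f y)%:M : 'M[R]_p) x.
Proof.
move=> df; under eq_fun do rewrite -scalemx1.
exact: mxderivable_scale df (@mxderivable_cst _ _ _ _ _ _).
Qed.

Lemma mxdirder_scalar p u (f : 'rV[R]_n -> R) x :
  pderivable f x ->
  mxdirder u (fun y => (f y)%:M : 'M[R]_p) x = (dirder u f x)%:M.
Proof.
move=> df; under eq_fun do rewrite -scalemx1.
rewrite (mxdirder_scale u df (@mxderivable_cst _ _ _ _ _ _)).
by rewrite mxdirder_cst scaler0 addr0 scalemx1.
Qed.

End BlockFields.

(** * Curvature of the warped product *)

Lemma trmx11 (R : pzRingType) (A : 'M[R]_1) : A^T = A.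
Proof. by apply/matrixP => i j; rewrite mxE !ord1. Qed.

Lemma row_mx_split (R : pzRingType) m (u : 'rV[R]_(1 + m)) :
  u = row_mx (lsubmx u 0 0)%:M (rsubmx u).
Proof. by rewrite -mx11_scalar hsubmxK. Qed.

(** A variant of [mx_abelian] for expressions with scalar matrices: the split on [i == j] evaluates
    their entries. *)
Ltac mx_entries :=
  repeat match goal with
  | |- context [mulmx ?A ?B] => let z := fresh "z" in move: (mulmx A B) => z
  | |- context [mxdirder ?u ?A ?x] =>
      let z := fresh "z" in move: (mxdirder u A x) => z
  | |- context [conn_mx ?g ?x ?u] =>
      let z := fresh "z" in move: (conn_mx g x u) => z
  end;
  let i := fresh "i" in let j := fresh "j" in
  apply/matrixP => i j; rewrite ?ord1 !mxE; try case: (i == j);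
  rewrite /= ?(mulr1n, mulr0n).

Section MetricForm.
Context {R : realType} {n : nat}.
Implicit Types (g : 'rV[R]_n -> 'M[R]_n) (x u v w : 'rV[R]_n).

Lemma gform_linearl g x t u v w :
  gform g x (t *: u + v) w = t * gform g x u w + gform g x v w.
Proof. by rewrite /gform !mulmxDl -!scalemxAl !mxE. Qed.

Lemma gformDl g x u v w : gform g x (u + v) w = gform g x u w + gform g x v w.
Proof. by rewrite -[u in LHS]scale1r gform_linearl mul1r. Qed.

Lemma gformZl g x t u w : gform g x (t *: u) w = t * gform g x u w.
Proof. by rewrite /gform -!scalemxAl mxE. Qed.

Lemma gformNl g x u w : gform g x (- u) w = - gform g x u w.
Proof. by rewrite -scaleN1r gformZl mulN1r. Qed.

Lemma gformC g x u v : (g x)^T = g x -> gform g x u v = gform g x v u.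
Proof.
move=> gS; rewrite /gform -[in LHS](trmx11 (u *m _ *m _)).
by rewrite !trmx_mul trmxK gS mulmxA.
Qed.

Lemma gform_bvecr g x u k : gform g x u (bvec R k) = (u *m g x) 0 k.
Proof. by rewrite /gform trmx_delta -colE mxE. Qed.

Lemma ricciE g x u v :
  (forall u, mxderivable (fun y => conn_mx g y u) x) ->
  ricci g x u v = \sum_k (v *m curv_mx g x (bvec R k) u) 0 k.
Proof.
by move=> dA; apply: eq_bigr => k _; rewrite mxE -/(bvec R k) curvE.
Qed.

End MetricForm.

Section WarpedCurvature.
Context {R : realType} {m : nat}.
Variables (h F : 'rV[R]_1 -> R) (g : 'rV[R]_m -> 'M[R]_m) (c : R).
Variables (U : set 'rV[R]_1) (V : set 'rV[R]_m).

Let d (f : 'rV[R]_1 -> R) := partial ord0 f.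

Hypothesis Uo : open U.
Hypothesis h0 : forall s, U s -> h s != 0.
Hypothesis F0 : forall s, U s -> F s != 0.
Hypothesis hD : forall s, U s -> pderivable h s.
Hypothesis hD2 : forall s, U s -> pderivable (d h) s.
Hypothesis FD : forall s, U s -> pderivable F s.
Hypothesis FD2 : forall s, U s -> pderivable (d F) s.
Hypothesis dFE : forall s, U s -> d F s ^+ 2 = 4 * c * h s * F s.

Hypothesis Vo : open V.
Hypothesis gS : forall y, V y -> (g y)^T = g y.
Hypothesis gU : forall y, V y -> g y \in unitmx.
Hypothesis gC : forall i j, Ck 2 V (fun y => g y i j).

Definition warped (y : 'rV[R]_(1 + m)) : 'M[R]_(1 + m) :=
  block_mx (h (lsubmx y))%:M 0 0 (F (lsubmx y) *: g (rsubmx y)).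

(* The Christoffel symbols of the warped product that do not come from the    *)
(* fiber: Gamma^1_11, Gamma^1_ab / g_ab and Gamma^b_1b.                       *)
Let gam s := d h s / (2 * h s).
Let p s := -1 * (d F s / (2 * h s)).
Let q s := d F s / (2 * F s).

(** The classical formulas for the connection of a warped product. Block rows belong to the
    differentiated vector, block columns to the result: the lower left block is the base part of the
    derivative of a fiber vector. *)
Definition warped_conn (y u : 'rV[R]_(1 + m)) : 'M[R]_(1 + m) :=
  block_mx (gam (lsubmx y) * lsubmx u 0 0)%:M (q (lsubmx y) *: rsubmx u)
    (p (lsubmx y) *: (g (rsubmx y) *m (rsubmx u)^T))
    (conn_mx g (rsubmx y) (rsubmx u) + (q (lsubmx y) * lsubmx u 0 0)%:M).

Lemma near_warped (P : 'rV[R]_(1 + m) -> Prop) z :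
  U (lsubmx z) -> V (rsubmx z) ->
  (forall y, U (lsubmx y) -> V (rsubmx y) -> P y) -> \forall y \near z, P y.
Proof.
move=> Uz Vz UVP.
have nU : \forall y \near z, U (lsubmx y).
  apply: (@continuous_lsubmx _ _ _ _ z U).
  exact: open_nbhs_nbhs.
have nV : \forall y \near z, V (rsubmx y).
  apply: (@continuous_rsubmx _ _ _ _ z V).
  exact: open_nbhs_nbhs.
by apply: filterS2 nU nV.
Qed.

Lemma dirder_base (u : 'rV[R]_(1 + m)) f z :
  dirder u (fun y => f (lsubmx y)) z = lsubmx u 0 0 * d f (lsubmx z).
Proof. by rewrite dirder_lsubmx /dirder big_ord1. Qed.

Lemma mxdirder_fiber a b u (A : 'rV[R]_m -> 'M[R]_(a, b)) (z : 'rV[R]_(1 + m)) :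
  mxdirder u (fun y => A (rsubmx y)) z = mxdirder (rsubmx u) A (rsubmx z).
Proof.
apply/matrixP => i j; rewrite !mxE.
exact: (dirder_rsubmx u (fun y => A y i j)).
Qed.

Lemma mxderivable_fiber a b (A : 'rV[R]_m -> 'M[R]_(a, b)) (z : 'rV[R]_(1 + m)) :
  mxderivable A (rsubmx z) -> mxderivable (fun y => A (rsubmx y)) z.
Proof.
move=> dA i j; exact: (@pderivable_rsubmx _ _ _ (fun y => A y i j) _ (dA i j)).
Qed.

Lemma warped_sym y : V (rsubmx y) -> (warped y)^T = warped y.
Proof.
by move=> Vy; rewrite /warped tr_block_mx tr_scalar_mx !trmx0 linearZ /= gS.
Qed.

Lemma warped_unit y : U (lsubmx y) -> V (rsubmx y) -> warped y \in unitmx.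
Proof.
move=> Uy Vy; rewrite unitmxE /warped det_ublock det_scalar detZ !unitrM.
rewrite !unitrX ?unitfE ?h0 ?F0 //=.
by rewrite -unitfE -unitmxE gU.
Qed.

(** The first identity produces the term with [c] in the fiber curvature; the other two make the
    mixed blocks of the curvature vanish. All of them follow from F'^2 = 4 c h F and its
    derivative. *)
Lemma base_partials s : U s ->
  [/\ p s * q s = - c, d p s + p s * gam s = - c & d q s + q s ^+ 2 = gam s * q s].
Proof.
move=> Us; have hs := h0 Us; have Fs := F0 Us.
have two : (2 : R) != 0 by rewrite pnatr_eq0.
have dM f1 f2 : pderivable f1 s -> pderivable f2 s ->
  d (fun s => f1 s * f2 s) s = d f1 s * f2 s + f1 s * d f2 s.
  exact: partialM.
(* This is the derivative of F'^2 = 4 c h F with [c] eliminated and a factor F' divided out. *)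
have id2 : 2 * h s * F s * d (d F) s = h s * d F s ^+ 2 + F s * d F s * d h s.
  have E : 2 * d F s * d (d F) s = 4 * c * (d h s * F s + h s * d F s).
    have e1 : d (fun s => d F s * d F s) s = 2 * d F s * d (d F) s.
      by rewrite (dM (d F) (d F) (FD2 Us) (FD2 Us)); ring.
    have e2 : d (fun s => (4 * c) * (h s * F s)) s
        = 4 * c * (d h s * F s + h s * d F s).
      rewrite (dM (fun=> 4 * c) (fun s => h s * F s) (@pderivable_cst _ _ _ _)
        (pderivableM (hD Us) (FD Us))).
      by rewrite [d (fun=> _) _]partial_cst mul0r add0r (dM h F (hD Us) (FD Us)).
    rewrite -e1 -e2; apply: near_partial.
    have : nbhs s U by exact: open_nbhs_nbhs.
    by apply: filterS => t Ut; rewrite -expr2 dFE // !mulrA.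
  have Es := dFE Us.
  (* Division fails where F' is zero. But then [c] is zero, since [h] and [F] are not, so F'
     vanishes on all of [U] and F'' is zero at [s]. *)
  have [dF0|dFN0] := eqVneq (d F s) 0.
    suff -> : d (d F) s = 0 by rewrite dF0; ring.
    have c0 : c = 0.
      apply/eqP; move/eqP: Es; rewrite dF0 expr0n /= eq_sym !mulf_eq0.
      by rewrite (negPf hs) (negPf Fs) pnatr_eq0 /= !orbF.
    have -> : d (d F) s = d (fun=> 0) s.
      apply: near_partial.
      have : nbhs s U by exact: open_nbhs_nbhs.
      apply: filterS => t Ut; apply/eqP; rewrite -sqrf_eq0 dFE //.
      by rewrite c0 mulr0 !mul0r.
    exact: partial_cst.
  apply: (mulfI dFN0).
  transitivity (h s * F s * (2 * d F s * d (d F) s)); first by ring.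
  rewrite E; transitivity (4 * c * h s * F s * (d h s * F s + h s * d F s)); first by ring.
  by rewrite -Es; ring.
have dinv f : f s != 0 -> pderivable f s ->
    pderivable (fun s => (2 * f s)^-1) s /\
    d (fun s => (2 * f s)^-1) s = - d f s / (2 * f s ^+ 2).
  move=> fs df.
  have d2f := pderivableM (@pderivable_cst _ _ (2 : R) s) df.
  have f2 : 2 * f s != 0 by rewrite mulf_neq0.
  split; first exact: pderivableV f2 d2f.
  rewrite [LHS](partialV ord0 f2 d2f) -/(d _) (dM (fun=> 2) f (@pderivable_cst _ _ _ _) df).
  by rewrite [d (fun=> _) _]partial_cst; field.
have [dh1 dh2] := dinv _ hs (hD Us); have [dF1 dF2] := dinv _ Fs (FD Us).
have cE : c = d F s ^+ 2 / (4 * h s * F s).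
  by rewrite dFE //; field; rewrite hs Fs.
have d2E : d (d F) s = (h s * d F s ^+ 2 + F s * d F s * d h s) / (2 * h s * F s).
  by rewrite -id2; field; rewrite hs Fs.
split.
- by rewrite /p /q cE; field; rewrite hs Fs.
- rewrite {1}/p (dM (fun=> -1) _ (@pderivable_cst _ _ _ _) (pderivableM (FD2 Us) dh1)).
  rewrite [d (fun=> _) _]partial_cst (dM (d F) _ (FD2 Us) dh1) dh2 d2E cE /p /gam.
  by field; rewrite hs Fs.
- rewrite {1}/q (dM (d F) _ (FD2 Us) dF1) dF2 d2E /q /gam.
  by field; rewrite hs Fs.
Qed.

Lemma mul_warped_conn y u v :
  v *m warped_conn y u
  = row_mx ((gam (lsubmx y) * lsubmx v 0 0 * lsubmx u 0 0)%:M
            + p (lsubmx y) *: (rsubmx v *m g (rsubmx y) *m (rsubmx u)^T))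
           ((q (lsubmx y) * lsubmx v 0 0) *: rsubmx u
            + rsubmx v *m conn_mx g (rsubmx y) (rsubmx u)
            + (q (lsubmx y) * lsubmx u 0 0) *: rsubmx v).
Proof.
rewrite {1}(row_mx_split v) mul_row_block.
rewrite -scalar_mxM mul_scalar_mx -scalemxAr mulmxDr mul_mx_scalar !mulmxA.
by rewrite !scalerA addrA (mulrC (lsubmx v 0 0) (q _)) mulrCA mulrA.
Qed.

(** By [conn_mx_unique] it suffices that [warped_conn] is linear, torsion-free and metric; the
    relation between F' and [c] does not enter yet. *)
Lemma conn_mx_warped y u : U (lsubmx y) -> V (rsubmx y) ->
  conn_mx warped y u = warped_conn y u.
Proof.
move=> Uy Vy.
have nS : \forall y \near y, (warped y)^T = warped y.
  by apply: (near_warped Uy Vy) => t _; exact: warped_sym.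
have nV (P : 'rV[R]_m -> Prop) :
    (forall y, V y -> P y) -> \forall t \near rsubmx y, P t.
  by move=> VP; apply: filterS VP _; exact: open_nbhs_nbhs.
have hy := h0 Uy; have Fy := F0 Uy.
apply: (conn_mx_unique (warped_unit Uy Vy) nS) => {u} [a u v|u v|u].
- rewrite /warped_conn scale_block_mx add_block_mx.
  rewrite !(linearP, conn_mxD, conn_mxZ) /=.
  by congr block_mx; mx_entries; ring.
- rewrite !mul_warped_conn; congr row_mx.
    rewrite -[rsubmx v *m _ *m _]trmx11 !trmx_mul trmxK gS // mulmxA.
    by congr (_%:M + _); ring.
  rewrite (conn_mx_torsion _ _ (gU Vy) (nV _ gS)).
  by mx_entries; ring.
- rewrite mxdirder_block !mxdirder_cst.
  rewrite (mxdirder_scalar 1 u (@pderivable_lsubmx _ _ _ h _ (hD Uy))).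
  rewrite (mxdirder_scale u (@pderivable_lsubmx _ _ _ F _ (FD Uy))
    (mxderivable_fiber (metric_mxderivable gC Vy))).
  rewrite !dirder_base mxdirder_fiber (conn_mx_metric _ (gU Vy) (nV _ gS)).
  rewrite /warped_conn /warped tr_block_mx !mulmx_block add_block_mx.
  congr block_mx.
  + rewrite mulmx0 mul0mx !addr0 tr_scalar_mx -!scalar_mxM -raddfD /=.
    by congr (_%:M); rewrite /gam; field.
  (* The mixed blocks vanish because p h + q F = 0. *)
  + rewrite mulmx0 mul0mx add0r addr0 mul_scalar_mx [(_ *: _)^T]linearZ /= trmx_mul trmxK.
    rewrite gS // -scalemxAl -scalemxAr !scalerA -scalerDl /p /q.
    by rewrite [X in X *: _](_ : _ = 0) ?scale0r //; field; rewrite hy Fy.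
  + rewrite mulmx0 mul0mx add0r addr0 mul_mx_scalar [(_ *: _)^T]linearZ /= scalerA.
    rewrite -scalemxAl -scalemxAr !scalerA -scalerDl /p /q.
    by rewrite [X in X *: _](_ : _ = 0) ?scale0r //; field; rewrite hy Fy.
  + rewrite mulmx0 mul0mx !add0r [(_ + _)^T]linearD /= tr_scalar_mx.
    rewrite mulmxDl mulmxDr mul_scalar_mx mul_mx_scalar -!scalemxAl -!scalemxAr.
    have -> : lsubmx u 0 0 * d F (lsubmx y)
        = 2 * (q (lsubmx y) * lsubmx u 0 0 * F (lsubmx y)).
      by rewrite /q; field.
    by mx_entries; ring.
Qed.

Lemma base_derivable s : U s ->
  [/\ pderivable gam s, pderivable p s & pderivable q s].
Proof.
move=> Us; have two : (2 : R) != 0 by rewrite pnatr_eq0.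
have dI f : f s != 0 -> pderivable f s -> pderivable (fun s => (2 * f s)^-1) s.
  move=> fs df; have d2f := pderivableM (@pderivable_cst _ _ (2 : R) s) df.
  by apply: pderivableV d2f; rewrite mulf_neq0.
have hI := dI h (h0 Us) (hD Us); have FI := dI F (F0 Us) (FD Us).
split; first exact: pderivableM (hD2 Us) hI.
- exact: pderivableM (@pderivable_cst _ _ _ _) (pderivableM (FD2 Us) hI).
- exact: pderivableM (FD2 Us) FI.
Qed.

Lemma warped_conn_derivable z v : U (lsubmx z) -> V (rsubmx z) ->
  mxderivable (fun y => warped_conn y v) z.
Proof.
move=> Uz Vz; have [dgam dp dq] := base_derivable Uz.
have dl f : pderivable f (lsubmx z) -> pderivable (fun y => f (lsubmx y)) z.
  exact: pderivable_lsubmx.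
apply: mxderivable_block.
- apply: mxderivable_scalar.
  exact: pderivableM (dl _ dgam) (@pderivable_cst _ _ _ _).
- exact: mxderivable_scale (dl _ dq) (@mxderivable_cst _ _ _ _ _ _).
- apply: mxderivable_scale (dl _ dp) _.
  apply: mxderivableM (@mxderivable_cst _ _ _ _ _ _).
  exact: mxderivable_fiber (metric_mxderivable gC Vz).
- apply: mxderivableD.
    apply: (@mxderivable_fiber _ _ (fun y => conn_mx g y (rsubmx v))).
    exact (conn_mx_derivable Vo gU gC Vz).
  apply: mxderivable_scalar.
  exact: pderivableM (dl _ dq) (@pderivable_cst _ _ _ _).
Qed.

Lemma mxdirder_warped_conn z u v : U (lsubmx z) -> V (rsubmx z) ->
  let s := lsubmx z in let x := rsubmx z in
  let u0 := lsubmx u 0 0 in let v0 := lsubmx v 0 0 in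
  mxdirder u (fun y => warped_conn y v) z
  = block_mx (u0 * d gam s * v0)%:M ((u0 * d q s) *: rsubmx v)
     ((u0 * d p s) *: (g x *m (rsubmx v)^T)
      + p s *: (mxdirder (rsubmx u) g x *m (rsubmx v)^T))
     (mxdirder (rsubmx u) (fun y => conn_mx g y (rsubmx v)) x
      + (u0 * d q s * v0)%:M).
Proof.
move=> Uz Vz s x u0 v0; have [dgam dp dq] := base_derivable Uz.
have dl f : pderivable f (lsubmx z) -> pderivable (fun y => f (lsubmx y)) z.
  exact: pderivable_lsubmx.
have dg := metric_mxderivable gC Vz.
rewrite mxdirder_block; congr block_mx.
- rewrite (mxdirder_scalar 1 u (pderivableM (dl _ dgam) (@pderivable_cst _ _ _ _))).
  by rewrite (dirderMr u _ (dl _ dgam)) dirder_base.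
- rewrite (mxdirder_scale u (dl _ dq) (@mxderivable_cst _ _ _ _ _ _)).
  by rewrite mxdirder_cst scaler0 addr0 dirder_base.
- have dgl := mxderivable_fiber dg.
  rewrite (mxdirder_scale u (dl _ dp) (mxderivableM dgl (@mxderivable_cst _ _ _ _ _ _))).
  by rewrite (mxdirderMr u _ dgl) mxdirder_fiber dirder_base.
- have dA := @mxderivable_fiber _ _ (fun y => conn_mx g y (rsubmx v)) z
    (conn_mx_derivable Vo gU gC Vz).
  have dqv := pderivableM (dl _ dq) (@pderivable_cst _ _ v0 _).
  rewrite (mxdirderD u dA (@mxderivable_scalar _ _ m _ _ dqv)) (mxdirder_scalar m u dqv).
  rewrite (dirderMr u _ (dl _ dq)) dirder_base.
  by rewrite (mxdirder_fiber u (fun y => conn_mx g y (rsubmx v))).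
Qed.

(** On a row vector [w] the term with [c] acts as the wedge of [u1] and [v1] formed with [g]. The
    base block vanishes because, the base being one-dimensional, all its contributions are symmetric
    in [u] and [v]. *)
Lemma curv_mx_warped z u v : U (lsubmx z) -> V (rsubmx z) ->
  let x := rsubmx z in let u1 := rsubmx u in let v1 := rsubmx v in
  curv_mx warped z u v
  = block_mx 0 0 0 (curv_mx g x u1 v1
                    - c *: (g x *m (v1^T *m u1 - u1^T *m v1))).
Proof.
move=> Uz Vz x u1 v1; rewrite /curv_mx.
(* The curvature differentiates the connection, so the formula for it is needed near [z] and not
   just at [z]. *)
have nearC a b : mxdirder a (fun y => conn_mx warped y b) z
    = mxdirder a (fun y => warped_conn y b) z.
  by apply: near_mxdirder; apply: (near_warped Uz Vz) => y; exact: conn_mx_warped.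
have nS : \forall y \near x, (g y)^T = g y.
  by apply: filterS gS _; exact: open_nbhs_nbhs.
have met a := conn_mx_metric a (gU Vz) nS.
have tor a b := conn_mx_torsion a b (gU Vz) nS.
rewrite !nearC !conn_mx_warped // !mxdirder_warped_conn // !met -/x -/u1 -/v1.
set s := lsubmx z; have [pq dpE dqE] := base_partials Uz.
rewrite -/s in pq dpE dqE.
set u0 := lsubmx u 0 0; set v0 := lsubmx v 0 0.
rewrite /warped_conn -/s -/x -/u0 -/v0 -/u1 -/v1.
rewrite !mulmx_block !add_block_mx opp_block_mx add_block_mx.
(* With [c], p' and q' expressed through gam, p and q, each block becomes a polynomial identity. *)
have cE : c = - (p s * q s) by rewrite pq opprK.
have dqs : d q s = gam s * q s - q s ^+ 2 by rewrite -dqE addrK.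
have dps : d p s = p s * q s - p s * gam s by rewrite pq -dpE addrK.
rewrite dqs dps cE.
move: (gam s) (d gam s) (p s) (q s) => gs gs' ps qs.
congr block_mx.
- rewrite -!scalar_mxM -!scalemxAl.
  have -> : v1 *m (ps *: (g x *m u1^T)) = u1 *m (ps *: (g x *m v1^T)).
    rewrite -!scalemxAr; congr (_ *: _).
    by rewrite -[LHS]trmx11 !trmx_mul trmxK gS // mulmxA.
  by mx_entries; ring.
- rewrite !mul_scalar_mx -!scalemxAl !mulmxDr !mul_mx_scalar tor.
  by mx_entries; ring.
- have torT : (conn_mx g x v1)^T *m u1^T = (conn_mx g x u1)^T *m v1^T.
    by rewrite -!trmx_mul tor.
  rewrite !mul_mx_scalar !mulmxDl !mul_scalar_mx -!scalemxAr -!mulmxA torT.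
  by mx_entries; ring.
- rewrite !mulmxDl !mulmxDr !mul_scalar_mx !mul_mx_scalar -!scalemxAl -!scalemxAr.
  rewrite !mulmxN -!mulmxA.
  by mx_entries; ring.
Qed.

Variable z : 'rV[R]_(1 + m).
Hypothesis Uz : U (lsubmx z).
Hypothesis Vz : V (rsubmx z).

Let x := rsubmx z.
Let W := warped.
Let Fz := F (lsubmx z).

Let K (a b : 'rV[R]_m) : 'M[R]_m :=
  curv_mx g x a b - c *: (g x *m (b^T *m a - a^T *m b)).

Let dA a : mxderivable (fun y => conn_mx g y a) x.
Proof. exact (conn_mx_derivable Vo gU gC Vz). Qed.

Let dAW u : mxderivable (fun y => conn_mx W y u) z.
Proof.
apply: (@near_mxderivable _ _ _ _ (fun y => warped_conn y u)).
  apply: (near_warped Uz Vz) => y Uy Vy.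
  by rewrite conn_mx_warped.
exact: warped_conn_derivable.
Qed.

Lemma curv_warped u v w :
  curv W z u v w = row_mx 0 (rsubmx w *m K (rsubmx u) (rsubmx v)).
Proof.
rewrite curvE //.
rewrite curv_mx_warped //.
rewrite -/(K _ _) {1}(row_mx_split w) mul_row_block.
by rewrite !mulmx0 addr0 add0r.
Qed.

(** The base direction contributes nothing to the trace. On the fiber the wedge term gives [m]
    copies of the metric from its first summand and takes one back with its second. *)
Lemma ricci_warped u v :
  ricci W z u v = ricci g x (rsubmx u) (rsubmx v)
                  - c * (m%:R - 1) * gform g x (rsubmx u) (rsubmx v).
Proof.
set u1 := rsubmx u; set v1 := rsubmx v.
rewrite [in RHS]ricciE // /ricci /mxtrace big_split_ord /= big1 ?add0r; last first.
  by move=> i _; rewrite mxE curv_warped row_mxEl mxE.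
have E k : lin1_mx (fun w => curv W z w u v) (rshift 1 k) (rshift 1 k)
    = (v1 *m curv_mx g x (bvec R k) u1) 0 k
      - c * (gform g x v1 u1 - gform g x v1 (bvec R k) * u1 0 k).
  rewrite mxE curv_warped row_mxEr -/(bvec R _) rsubmx_bvecr -/u1 -/v1.
  rewrite /K; move: (curv_mx g x (bvec R k) u1) => Ck.
  rewrite mulmxBr -scalemxAr !mulmxBr !mulmxA.
  have sub (A B D : 'rV[R]_m) t :
    (A - t *: (B - D)) 0 k = A 0 k - t * (B 0 k - D 0 k) by rewrite !mxE.
  have mul11 (A : 'M[R]_1) (w : 'rV[R]_m) : (A *m w) 0 k = A 0 0 * w 0 k.
    by rewrite mxE big_ord1.
  by rewrite sub !mul11 [bvec R k 0 k]mxE !eqxx mulr1.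
under eq_bigr do rewrite E.
rewrite sumrB -mulr_sumr sumrB sumr_const card_ord; congr (_ - _).
have -> : \sum_k gform g x v1 (bvec R k) * u1 0 k = gform g x v1 u1.
  under eq_bigr do rewrite gform_bvecr.
  by rewrite /gform mxE; apply: eq_bigr => k _; rewrite !mxE.
by rewrite (gformC v1 u1 (gS Vz)) -mulrA mulrBl mul1r mulr_natl.
Qed.

End WarpedCurvature.

(** * Algebra of the curvature tensors at a point *)

Section SkewDerivation.
Context {R : comPzRingType} {T : Type}.

(* The tensor associated with (X, Y) |-> X /\ S Y + S X /\ Y - X /\ Y, where  *)
(* G is the metric and P the form of the endomorphism S.                      *)
Definition wedge4 (G P : T -> T -> R) (u1 u2 u3 u4 : T) : R :=
  P u2 u3 * G u1 u4 - G u1 u3 * P u2 u4 + G u2 u3 * P u1 u4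
  - P u1 u3 * G u2 u4 - G u2 u3 * G u1 u4 + G u1 u3 * G u2 u4.

(** [A] acts as a skew map for both forms, hence as a derivation killing [G] and [P] and any
    expression in them. That both pairings with [A u] are the same [S] reflects that [A] takes
    values where the two forms agree. *)
Lemma wedge4_skew (G P S : T -> T -> R) (A : T -> T) u1 u2 u3 u4 :
  (forall u v, G u v = G v u) -> (forall u v, P u v = P v u) ->
  (forall u v, G (A u) v = S u v) -> (forall u v, P (A u) v = S u v) ->
  (forall u v, S u v = - S v u) ->
  wedge4 G P (A u1) u2 u3 u4 + wedge4 G P u1 (A u2) u3 u4
  + wedge4 G P u1 u2 (A u3) u4 + wedge4 G P u1 u2 u3 (A u4) = 0.
Proof.
move=> GC PC GA PA SC.
have GA' u v : G u (A v) = S v u by rewrite GC GA.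
have PA' u v : P u (A v) = S v u by rewrite PC PA.
rewrite /wedge4 !GA !GA' !PA !PA'.
rewrite (SC u3 u1) (SC u4 u1) (SC u3 u2) (SC u4 u2).
ring.
Qed.

End SkewDerivation.

Section DotLinear.
Context {R : realType} {n : nat}.
Implicit Types (T : tensor4 R n) (u v w : 'rV[R]_n).

Lemma dot_tensor_linear B T T1 T2 k u1 u2 u3 u4 u v :
  (forall a1 a2 a3 a4, T a1 a2 a3 a4 = T1 a1 a2 a3 a4 - k * T2 a1 a2 a3 a4) ->
  dot B T u1 u2 u3 u4 u v
  = dot B T1 u1 u2 u3 u4 u v - k * dot B T2 u1 u2 u3 u4 u v.
Proof. by move=> TE; rewrite /dot !TE; ring. Qed.

(** The hypothesis compares values of [T] instead of vectors, because in the application the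
    operators are related only modulo the base direction, which the curvature tensor does not
    see. *)
Lemma dot_op_linear (B B1 B2 : 'rV[R]_n -> 'rV[R]_n -> 'rV[R]_n -> 'rV[R]_n)
    T k u1 u2 u3 u4 u v :
  (forall w, [/\ forall a2 a3 a4,
     T (B u v w) a2 a3 a4 = T (B1 u v w) a2 a3 a4 - k * T (B2 u v w) a2 a3 a4,
     forall a1 a3 a4,
     T a1 (B u v w) a3 a4 = T a1 (B1 u v w) a3 a4 - k * T a1 (B2 u v w) a3 a4,
     forall a1 a2 a4,
     T a1 a2 (B u v w) a4 = T a1 a2 (B1 u v w) a4 - k * T a1 a2 (B2 u v w) a4
   & forall a1 a2 a3,
     T a1 a2 a3 (B u v w) = T a1 a2 a3 (B1 u v w) - k * T a1 a2 a3 (B2 u v w)]) ->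
  dot B T u1 u2 u3 u4 u v
  = dot B1 T u1 u2 u3 u4 u v - k * dot B2 T u1 u2 u3 u4 u v.
Proof.
move=> H; rewrite /dot.
have [-> _ _ _] := H u1; have [_ -> _ _] := H u2; have [_ _ -> _] := H u3.
have [_ _ _ ->] := H u4.
by ring.
Qed.

End DotLinear.

(** * The identity at a point where the curvature has only fiber components *)

Section FlatBaseDirection.
Context {R : realType} {m : nat}.
Variables (g : 'rV[R]_(1 + m) -> 'M[R]_(1 + m)) (z : 'rV[R]_(1 + m)).
Variables (h f lam : R) (b : 'M[R]_m) (K : 'rV[R]_m -> 'rV[R]_m -> 'M[R]_m).

Let bf (u v : 'rV[R]_m) : R := (u *m b *m v^T) 0 0.

Hypothesis m0 : (0 < m)%N.
Hypothesis f0 : f != 0.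
Hypothesis gz : g z = block_mx h%:M 0 0 (f *: b).
Hypothesis gz_unit : g z \in unitmx.
Hypothesis bS : b^T = b.
Hypothesis K_linear : forall t u u' v, K (t *: u + u') v = t *: K u v + K u' v.
Hypothesis KC : forall u v, K v u = - K u v.
Hypothesis K_skew : forall u v, K u v *m b + b *m (K u v)^T = 0.
Hypothesis curvK : forall u v w,
  curv g z u v w = row_mx 0 (rsubmx w *m K (rsubmx u) (rsubmx v)).
Hypothesis ricb : forall u v, ricci g z u v = lam * bf (rsubmx u) (rsubmx v).

Let G := gform g z.
Let P (u v : 'rV[R]_(1 + m)) := f * bf (rsubmx u) (rsubmx v).
Let rho := lam / f.

Let G_split u v : G u v = h * lsubmx u 0 0 * lsubmx v 0 0 + P u v.
Proof.
rewrite /G /gform {1}(row_mx_split u) {1}(row_mx_split v) gz mul_row_block.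
rewrite tr_row_mx tr_scalar_mx !mulmx0 addr0 add0r mul_row_col.
rewrite /P /bf -!scalar_mxM -!scalemxAr -!scalemxAl !mxE eqxx mulr1n.
by congr (_ + _); ring.
Qed.

Let G_row0 a v : G (row_mx 0 a) v = f * bf a (rsubmx v).
Proof. by rewrite G_split /P row_mxKl row_mxKr mxE mulr0 mul0r add0r. Qed.

Let ricci_opE u : ricci_op g z u = row_mx 0 (rho *: rsubmx u).
Proof.
rewrite /ricci_op -[RHS](mulmxK gz_unit); congr (_ *m _).
rewrite gz mul_row_block !mulmx0 mul0mx addr0 add0r -scalemxAl -scalemxAr.
rewrite scalerA /rho divfK //; apply/rowP => j; rewrite mxE ricb.
case: (split_ordP j) => k ->.
  rewrite row_mxEl mxE rsubmx_bvecl /bf trmx0 mulmx0 mxE mulr0 //.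
rewrite row_mxEr rsubmx_bvecr mxE; congr (_ * _).
by rewrite /bf trmx_delta -colE mxE.
Qed.

(** The Ricci operator has eigenvalue 0 on the base and [rho] on the fiber, whose dimension [m] is
    exactly the divisor. *)
Let scalE : scal g z / ((1 + m)%:R - 1) = rho.
Proof.
rewrite /scal /mxtrace big_split_ord /= big1 ?add0r; last first.
  by move=> i _; rewrite mxE ricci_opE row_mxEl mxE.
have E k : lin1_mx (ricci_op g z) (rshift 1 k) (rshift 1 k) = rho.
  rewrite mxE ricci_opE row_mxEr -/(bvec R _) rsubmx_bvecr !mxE !eqxx.
  by rewrite mulr1.
under eq_bigr do rewrite E.
rewrite sumr_const card_ord natrD mulr1n [_ - 1]addrC addKr -[rho *+ m]mulr_natr mulfK //.
by rewrite pnatr_eq0 -lt0n.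
Qed.

Let E4 u v w :=
  wedge G u (ricci_op g z v) w + wedge G (ricci_op g z u) v w
  - rho *: wedge G u v w.

Let weylE u v w : weyl_op g z u v w = curv g z u v w - ((1 + m)%:R - 2%:R)^-1 *: E4 u v w.
Proof. by rewrite /weyl_op scalE. Qed.

Let G_ricci_op u v : G (ricci_op g z u) v = rho * P u v.
Proof. by rewrite ricci_opE G_row0 /P /bf -!scalemxAl mxE mulrCA. Qed.

Let rsubmx_ricci_op u : rsubmx (ricci_op g z u) = rho *: rsubmx u.
Proof. by rewrite ricci_opE row_mxKr. Qed.

(** On the fiber, the metric terms carrying the Ricci operator outside the form have coefficient
    [rho]; by [scalE] so has the scalar curvature term, and they cancel. *)
Let rsubmx_E4 u v w : rsubmx (E4 u v w) = rsubmx (wedge (ricci g z) u v w).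
Proof.
have ricP s t : ricci g z s t = rho * P s t by rewrite ricb /rho /P mulrA divfK.
rewrite /E4 /wedge !ricP !G_ricci_op.
rewrite !(linearB, linearD, linearZ) /= !rsubmx_ricci_op.
by apply/rowP => k; rewrite !mxE; ring.
Qed.

Let G_E4 u1 u2 u3 u4 : G (E4 u1 u2 u3) u4 =
  rho * wedge4 G P u1 u2 u3 u4.
Proof.
rewrite /E4 /wedge /wedge4 !G_ricci_op /G.
rewrite -scaleNr !(gformDl, gformNl, gformZl) -!/(G _ _) !G_ricci_op.
by ring.
Qed.

Let GC u v : G u v = G v u.
Proof.
apply: gformC; rewrite gz tr_block_mx tr_scalar_mx !trmx0.
by rewrite [(_ *: _)^T]linearZ /= bS.
Qed.

Let PC u v : P u v = P v u.
Proof.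
rewrite /P /bf -[in LHS](trmx11 (_ *m _ *m _)).
by rewrite !trmx_mul trmxK bS mulmxA.
Qed.

Let G_curv u v w t : G (curv g z u v w) t = P (curv g z u v w) t.
Proof. by rewrite curvK G_row0 /P row_mxKr. Qed.

Let P_curv_skew u v w t : P (curv g z u v w) t = - P (curv g z u v t) w.
Proof.
rewrite !curvK /P !row_mxKr -mulrN; congr (_ * _); rewrite /bf.
have /eqP := K_skew (rsubmx u) (rsubmx v); rewrite addr_eq0 => /eqP Ks.
rewrite -(mulmxA (rsubmx w)) Ks mulmxN mulNmx mxE; congr (- _).
rewrite -[in LHS](trmx11 (_ *m _ *m _)) !trmx_mul !trmxK bS.
by rewrite !mulmxA.
Qed.

(** This is R . (R - C) = 0 up to a factor. Values of the curvature operator lie in the fiber, where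
    [G] and [P] coincide, and it is skew for [P], so [wedge4_skew] applies. *)
Let dot_G_E4 u1 u2 u3 u4 u v :
  dot (curv g z) (fun u1 u2 u3 u4 => G (E4 u1 u2 u3) u4) u1 u2 u3 u4 u v = 0.
Proof.
have H := wedge4_skew u1 u2 u3 u4 GC PC (fun w t => G_curv u v w t)
  (fun w t => erefl) (fun w t => P_curv_skew u v w t).
by rewrite /dot !G_E4 -!mulrDr H mulr0 oppr0.
Qed.

Let r4 (a1 a2 a3 a4 : 'rV[R]_m) := f * bf (a3 *m K a1 a2) a4.

Let R4E u1 u2 u3 u4 :
  R4 g z u1 u2 u3 u4 = r4 (rsubmx u1) (rsubmx u2) (rsubmx u3) (rsubmx u4).
Proof. by rewrite /R4 curvK -/(G _ _) G_row0. Qed.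

Let bf_linearl t a a' a'' : bf (t *: a + a') a'' = t * bf a a'' + bf a' a''.
Proof. by rewrite /bf !mulmxDl -!scalemxAl !mxE. Qed.

Let bf_linearr t a a' a'' : bf a'' (t *: a + a') = t * bf a'' a + bf a'' a'.
Proof. by rewrite /bf linearP /= mulmxDr -scalemxAr !mxE. Qed.

Let r4_linear1 t a a' a2 a3 a4 :
  r4 (t *: a + a') a2 a3 a4 = t * r4 a a2 a3 a4 + r4 a' a2 a3 a4.
Proof. by rewrite /r4 K_linear mulmxDr -scalemxAr bf_linearl; ring. Qed.

Let r4_linear2 t a a' a1 a3 a4 :
  r4 a1 (t *: a + a') a3 a4 = t * r4 a1 a a3 a4 + r4 a1 a' a3 a4.
Proof.
rewrite /r4; have -> : K a1 (t *: a + a') = t *: K a1 a + K a1 a'.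
  by rewrite KC K_linear opprD -scalerN -!KC.
by rewrite mulmxDr -scalemxAr bf_linearl; ring.
Qed.

Let r4_linear3 t a a' a1 a2 a4 :
  r4 a1 a2 (t *: a + a') a4 = t * r4 a1 a2 a a4 + r4 a1 a2 a' a4.
Proof. by rewrite /r4 mulmxDl -scalemxAl bf_linearl; ring. Qed.

Let r4_linear4 t a a' a1 a2 a3 :
  r4 a1 a2 a3 (t *: a + a') = t * r4 a1 a2 a3 a + r4 a1 a2 a3 a'.
Proof. by rewrite /r4 bf_linearr; ring. Qed.

(** Both products differ from R . R by a multiple of [k]: for R . C the difference is zero by
    [dot_G_E4], while for C . R it is -k Q(S, R), since [R4] depends only on fiber components and
    [rsubmx_E4] identifies these. *)
Lemma dot_curv_weyl u1 u2 u3 u4 u v :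
  dot (curv g z) (C4 g z) u1 u2 u3 u4 u v
  - dot (weyl_op g z) (R4 g z) u1 u2 u3 u4 u v
  = ((1 + m)%:R - 2%:R)^-1 * Q (ricci g z) (R4 g z) u1 u2 u3 u4 u v.
Proof.
set k := (_ - _)^-1.
have C4E a1 a2 a3 a4 : C4 g z a1 a2 a3 a4 = R4 g z a1 a2 a3 a4 - k * G (E4 a1 a2 a3) a4.
  by rewrite /C4 weylE gformDl gformNl gformZl.
have rsW w : rsubmx (weyl_op g z u v w)
    = - k *: rsubmx (wedge (ricci g z) u v w) + rsubmx (curv g z u v w).
  by rewrite weylE -rsubmx_E4 linearB linearZ /= scaleNr addrC.
rewrite (dot_tensor_linear _ _ _ _ _ _ _ C4E) dot_G_E4 mulr0 subr0.
rewrite (@dot_op_linear _ _ (weyl_op g z) (curv g z) (wedge (ricci g z)) (R4 g z) k).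
  by rewrite opprB addrC subrK.
move=> w; split=> [a2 a3 a4|a1 a3 a4|a1 a2 a4|a1 a2 a3]; rewrite !R4E rsW.
- by rewrite r4_linear1 mulNr addrC.
- by rewrite r4_linear2 mulNr addrC.
- by rewrite r4_linear3 mulNr addrC.
- by rewrite r4_linear4 mulNr addrC.
Qed.

End FlatBaseDirection.

Lemma dot_curv_weyl_warped (R : realType) (m : nat) (h F : 'rV[R]_1 -> R)
    (g : 'rV[R]_m -> 'M[R]_m) (c kap : R) (U : set 'rV[R]_1)
    (V : set 'rV[R]_m) (z : 'rV[R]_(1 + m)) :
  (0 < m)%N -> open U -> open V -> U (lsubmx z) -> V (rsubmx z) ->
  (forall s, U s -> h s != 0) -> (forall s, U s -> F s != 0) ->
  (forall s, U s -> pderivable h s /\ pderivable (partial ord0 h) s) ->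
  (forall s, U s -> pderivable F s /\ pderivable (partial ord0 F) s) ->
  (forall s, U s -> partial ord0 F s ^+ 2 = 4 * c * h s * F s) ->
  (forall y, V y -> (g y)^T = g y) -> (forall y, V y -> g y \in unitmx) ->
  (forall i j, Ck 2 V (fun y => g y i j)) ->
  (forall a b, ricci g (rsubmx z) a b = kap * gform g (rsubmx z) a b) ->
  forall u1 u2 u3 u4 u v,
  dot (curv (warped h F g) z) (C4 (warped h F g) z) u1 u2 u3 u4 u v
  - dot (weyl_op (warped h F g) z) (R4 (warped h F g) z) u1 u2 u3 u4 u v
  = ((1 + m)%:R - 2%:R)^-1
    * Q (ricci (warped h F g) z) (R4 (warped h F g) z) u1 u2 u3 u4 u v.
Proof.
move=> m0 Uo Vo Uz Vz h0 F0 hd Fd dFE gS gU gC ric u1 u2 u3 u4 u v.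
have hD s Us := (hd s Us).1; have hD2 s Us := (hd s Us).2.
have FD s Us := (Fd s Us).1; have FD2 s Us := (Fd s Us).2.
pose K a b := curv_mx g (rsubmx z) a b
  - c *: (g (rsubmx z) *m (b^T *m a - a^T *m b)).
apply: (@dot_curv_weyl _ _ _ _ (h (lsubmx z)) (F (lsubmx z))
  (kap - c * (m%:R - 1)) (g (rsubmx z)) K) => //.
- exact: F0.
- exact (warped_unit h0 F0 gU Uz Vz).
- exact: gS.
- move=> t a a' b; rewrite /K curv_mx_linear => [|w]; last first.
    exact (conn_mx_derivable Vo gU gC Vz).
  move: (curv_mx _ _ a b) (curv_mx _ _ a' b) => Ca Ca'.
  rewrite [(_ + _)^T]linearP /= !(mulmxN, mulmxDr, mulmxDl).
  rewrite -!scalemxAl -!scalemxAr.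
  by mx_entries; ring.
- move=> a b; rewrite /K curv_mxC; move: (curv_mx _ _ a b) => C.
  by rewrite !mulmxBr; mx_entries; ring.
(* The fiber curvature is skew by [curv_mx_skew]; the wedge term is skew because an antisymmetric
   matrix stays so between two factors [g]. *)
- move=> a b; have := curv_mx_skew Vo gS gU gC a b Vz.
  rewrite /K; move: (curv_mx _ _ a b) => C Cs.
  set X := g _ *m (_ - _).
  rewrite mulmxBl [(_ - _)^T]linearB /= mulmxBr addrACA Cs add0r /X.
  rewrite [(_ *: _)^T]linearZ /= trmx_mul [(_ - _)^T]linearB /= !trmx_mul.
  rewrite !trmxK gS // -!scalemxAl -!scalemxAr !(mulmxN, mulNmx, mulmxDr, mulmxDl) !mulmxA.
  by mx_entries; ring.
- move=> a b w.
  exact (curv_warped Uo h0 F0 hD hD2 FD FD2 dFE Vo gS gU gC Uz Vz a b w).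
- move=> a b.
  rewrite (ricci_warped Uo h0 F0 hD hD2 FD FD2 dFE Vo gS gU gC Uz Vz) ric.
  by rewrite mulrBl.
Qed.

(** * The warping function in a chart of the base, and the theorem *)

Lemma pderivable_Ck2 (R : realType) (n : nat) (U : set 'rV[R]_n)
    (f : 'rV[R]_n -> R) x :
  Ck 2 U f -> U x -> pderivable f x /\ forall k, pderivable (partial k f) x.
Proof.
move=> [_ Cf] Ux; split=> [k|k l]; first exact: (Cf k).1.
by have [_ [_ /(_ l)[+ _]]] := Cf k; exact.
Qed.

(** Let tau be the change of coordinates to x1. Then F = (a tau + b)^2 near the point, so F' = 2 a
    (a tau + b) tau', and the transformation law of the metric reads h = eps tau'^2. The derivatives
    of F exist because tau is smooth. *)
Lemma quadratic_warping_local (R : realType) (M : semiriem R 1) (eps a b : R)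
    (F : carrier M -> R) (i : chart_index M) s :
  eps ^+ 2 = 1 -> is_semiriemannian M -> quadratic_warping eps a b F ->
  cod (charts M i) s ->
  let f s := F (psi (charts M i) s) in
  [/\ pderivable f s, pderivable (partial ord0 f) s
    & partial ord0 f s ^+ 2 = 4 * (eps * a ^+ 2) * metric M i s 0 0 * f s].
Proof.
move=> eps2 [[_ _ _ [_ Mch] _] _ _ _ _] Fq Us f.
have [c [cs [[co _ _ _ _] /(_ i)[tc _ law]] Fc]] := Fq (psi (charts M i) s).
have [[Mdo Mco] _ Mpsi _ Mcont] := Mch i.
pose O := overlap (charts M i) c.
pose tau y := transition (charts M i) c y 0 0.
have Oo y : O y -> nbhs y O.
  move=> [Uy dy]; apply: filterI; first exact: open_nbhs_nbhs.
  by apply: (Mcont y Uy); apply: open_nbhs_nbhs; split => //; exact: co.1.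
have Os : O s by [].
have Ctau : Ck 2 O tau by exact: tc.
have dtau y (Oy : O y) := pderivable_Ck2 Ctau Oy.
pose l y := a * tau y + b.
have dl y : O y -> pderivable l y.
  move=> Oy; apply: pderivableD (@pderivable_cst _ _ _ _).
  exact: pderivableM (@pderivable_cst _ _ _ _) (dtau y Oy).1.
have pl y : O y -> partial ord0 l y = a * partial ord0 tau y.
  move=> Oy; have dt := (dtau y Oy).1.
  rewrite /l (partialD _ (pderivableM (@pderivable_cst _ _ a _) dt) (@pderivable_cst _ _ b _)).
  by rewrite (partialM _ (@pderivable_cst _ _ a _) dt) !partial_cst mul0r add0r addr0.
have fE y : O y -> \forall t \near y, l t * l t = f t.
  by move=> Oy; apply: filterS (Oo y Oy) => t [_ dt]; rewrite /f Fc // expr2.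
have pf y : O y -> partial ord0 f y = 2 * a * l y * partial ord0 tau y.
  move=> Oy; rewrite -(near_partial ord0 (fE y Oy)).
  by rewrite (partialM _ (dl y Oy) (dl y Oy)) pl //; ring.
split.
- exact: near_pderivable (fE s Os) (pderivableM (dl s Os) (dl s Os)).
- apply: (@near_pderivable _ _ (fun y => 2 * a * l y * partial ord0 tau y)).
    by apply: filterS (Oo s Os) => y Oy; rewrite pf.
  apply: pderivableM (pderivableM (@pderivable_cst _ _ _ _) (dl s Os)) _.
  exact: (dtau s Os).2.
(* The right side contains eps twice, once from the constant and once from the metric; inserting
   eps^2 = 1 on the left matches it. *)
- rewrite pf // /f Fc // (law s Os) mxE big_ord1 mxE big_ord1 !mxE eqxx mulr1n.
  rewrite -/(tau s) -/(l s).
  transitivity (4 * a ^+ 2 * l s ^+ 2 * partial ord0 tau s ^+ 2); first by ring.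
  rewrite -[LHS]mul1r -eps2 /tau.
  by ring.
Qed.
Theorem corollary4p2 (R : realType) (n : nat) (eps a b : R)
    (hn : (4 <= n.-1)%N) (heps : eps = 1 \/ eps = -1) :
  (forall N : semiriem R n.-1, is_semiriemannian N -> einstein N ->
   forall (i : chart_index N) (x : 'rV[R]_n.-1), cod (charts N i) x ->
   forall mu be ga de : 'I_n.-1,
     let g := metric N i in
     let S := fun p q => ricci g x (bvec R p) (bvec R q) in
     let Rc := fun p q r s =>
       R4 g x (bvec R p) (bvec R q) (bvec R r) (bvec R s) in
     let G := fun p q r s =>
       G4 g x (bvec R p) (bvec R q) (bvec R r) (bvec R s) in
     let kappa := scal g x in
     \sum_e (\sum_nu invmx (g x) e nu * S mu nu) * Rc e be ga de
     = kappa / n.-1%:R * Rc mu be ga de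
       + eps * a ^+ 2 * (g x be ga * S mu de - g x be de * S mu ga)
       - eps * kappa * a ^+ 2 / n.-1%:R * G mu be ga de)
  /\
  (forall (M : semiriem R 1) (N : semiriem R n.-1) (F : carrier M -> R),
   is_semiriemannian M -> is_semiriemannian N ->
   einstein N -> ~ constant_curvature N ->
   (forall p, 0 < F p) -> quadratic_warping eps a b F ->
   let W := warped_product F N in
   forall (i : chart_index W) (z : 'rV[R]_(1 + n.-1)), cod (charts W i) z ->
   forall u1 u2 u3 u4 u v : 'rV[R]_(1 + n.-1),
     let g := metric W i in
     dot (curv g z) (C4 g z) u1 u2 u3 u4 u v
     - dot (weyl_op g z) (R4 g z) u1 u2 u3 u4 u v
     = (n%:R - 2%:R)^-1 * Q (ricci g z) (R4 g z) u1 u2 u3 u4 u v).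
Proof.
have gbv (g : 'rV[R]_n.-1 -> 'M[R]_n.-1) x p q :
    gform g x (bvec R p) (bvec R q) = g x p q.
  by rewrite gform_bvecr -rowE mxE.
split.
  move=> N [_ _ gS gU _] Ein i x Vx mu be ga de g S Rc G kappa.
  have SE p q : S p q = kappa / n.-1%:R * g x p q by rewrite /S Ein // gbv.
  have gSx : (g x)^T = g x by exact: gS.
  have gC p q : g x p q = g x q p by rewrite -[in LHS]gSx mxE.
  have inv e p : \sum_nu invmx (g x) e nu * g x nu p = (e == p)%:R.
    by have /matrixP/(_ e p) := mulVmx (gU i x Vx); rewrite !mxE.
  (* With one index raised, the Ricci tensor is a multiple of the Kronecker delta, so only the term
     with [e] equal to [mu] survives. *)
  have -> : \sum_e (\sum_nu invmx (g x) e nu * S mu nu) * Rc e be ga de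
      = kappa / n.-1%:R * Rc mu be ga de.
    rewrite (bigD1 mu) //= [X in _ + X]big1 ?addr0 => [|e emu].
      under eq_bigr do rewrite SE mulrCA gC.
      by rewrite -mulr_sumr inv eqxx mulr1.
    under eq_bigr do rewrite SE mulrCA gC.
    by rewrite -mulr_sumr inv (negPf emu) mulr0 mul0r.
  (* The two terms with [a ^+ 2] are now the same multiple of the same expression in the metric,
     with opposite signs. *)
  rewrite !SE /G /G4 /wedge gformDl gformNl !gformZl !gbv.
  by ring.
move=> M N F Mg Ng Ein _ Fpos Fq W i z zUV u1 u2 u3 u4 u v.
have eps2 : eps ^+ 2 = 1 by case: heps => ->; rewrite ?sqrrN expr1n.
have loc := quadratic_warping_local eps2 Mg Fq.
case: Mg => [[_ _ _ [_ Mch] _] hs _ hU _].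
case: Ng => [[_ _ _ [_ Nch] _] gs gS gU _].
case: i zUV => i j [Uz Vz] g.
have gE : g = warped (fun s => metric M i s 0 0)
    (fun s => F (psi (charts M i) s)) (metric N j).
  by apply/funext => y; rewrite /g /= /warped -mx11_scalar.
(* The product has dimension [1 + n.-1]; this is [n] because [hn] excludes [n = 0], where the
   predecessor is truncated. *)
have nE : n%:R = (1 + n.-1)%:R :> R.
  by rewrite add1n prednK // -ltnS; case: (n) hn.
rewrite nE gE.
apply: (@dot_curv_weyl_warped _ _ _ _ _ (eps * a ^+ 2)
  (scal (metric N j) (rsubmx z) / n.-1%:R) (cod (charts M i)) (cod (charts N j))) => //.
- exact: leq_trans hn.
- by have [[]] := Mch i.
- by have [[]] := Nch j.
- by move=> s Us; have := hU i s Us; rewrite unitmxE det_mx11 unitfE.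
- by move=> s _; rewrite gt_eqF.
- move=> s Us; have [d1 d2] := pderivable_Ck2 (hs i 0 0 2%N) Us.
  by split; [exact: d1|exact: d2].
- by move=> s Us; have [] := loc i s Us.
- by move=> s Us; have [] := loc i s Us.
- exact: gS.
- exact: gU.
- by move=> k l; exact: gs.
- by move=> p q; exact: Ein.
Qed.
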